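(* Let $a=(a_{ij})_{1\le i\le j\le n}\in(\mathbb C^\times)^N$, $b=(b_{ij})\in\mathbb C^N$, $\lambda=(\lambda_i)\in\mathbb C^n$, $\mathbf a\in\mathbb C^\times$, and let $\widetilde{\mathrm{ev}}^\pm_{\mathbf a}=\rho(a,b,\lambda)\circ\mathrm{ev}^\pm_{\mathbf a^\lambda_\pm}:\widetilde U_\varepsilon\to\mathrm{End}(V_N)$. Then for every $i\in I$ and $m\in\{0,\dots,l-1\}^N$: $\widetilde{\mathrm{ev}}^\pm_{\mathbf a}(E_i)v(m)=\rho(E_i)v(m)$, $\widetilde{\mathrm{ev}}^\pm_{\mathbf a}(F_i)v(m)=\rho(F_i)v(m)$, $\widetilde{\mathrm{ev}}^\pm_{\mathbf a}(K_{\alpha_i})v(m)=\rho(K_{\alpha_i})v(m)$, $$\widetilde{\mathrm{ev}}^\pm_{\mathbf a}(E_0)v(m)=\mathbf a\sum_{r^s\in R^F}(-1)^{s+n}a(\epsilon_{r^s})\varepsilon^{\pm(C_E(m+b,r^s)-\lambda^{(s)}-s)+n}[-m_{s-1,s-1}+m_{s,s}-b_{s-1,s-1}+b_{s,s}-\lambda_s]_\varepsilon\,v(m+\epsilon_{r^s}),$$ $$\widetilde{\mathrm{ev}}^\pm_{\mathbf a}(F_0)v(m)=\mathbf a^{-1}\sum_{r^s\in R^E}(-1)^{s-1}a(\alpha_{r^s})\varepsilon^{\pm(D_F(m+b,r^s)-s+n+1)-n}[-m_{1,n-s+1}-b_{1,n-s+1}]_\varepsilon\,v(m+\alpha_{r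^s}).$$
   Context: $n\ge1$, $I=\{1,\dots,n\}$, $N=n(n+1)/2$; $l>2$ odd with $\gcd(l,n+1)=1$; $\varepsilon$ a primitive $l$-th root of unity. Complex powers $\varepsilon^c$ are taken with respect to a fixed logarithm of $\varepsilon$ (for $c\in\frac1{n+1}\mathbb Z$ this agrees with $\varepsilon^{c'}$, $c'\in\mathbb Z$, $c'\equiv c$ mod $l$); $[c]_\varepsilon=(\varepsilon^c-\varepsilon^{-c})/(\varepsilon-\varepsilon^{-1})$; $[u,v]_x=uv-xvu$. $\alpha_i$ simple roots, $Q$, $(\alpha_i,\alpha_j)$ the $\mathfrak{sl}_{n+1}$ Cartan matrix, $\theta=\sum\alpha_i$; $\Lambda_i$ fundamental weights, $P$, $(\Lambda_i,\alpha_j)=\delta_{ij}$, $(\Lambda_i,\Lambda_j)=\min(i,j)(n+1-\max(i,j))/(n+1)$; $\lambda_{\Lambda_i}=\sum_j\lambda_j(\Lambda_i,\Lambda_j)$; $\lambda^{(s)}=\sum_{k=1}^{s-1}\lambda_k-\sum_{k=s+1}^n\lambda_k$. Algebras: $U'_\varepsilon$ is the $\mathbb C$-algebra generated by $E_i,F_i$ ($i\in I$), $K_\mu$ ($\mu\in P$) with the relations of $U_q(\mathfrak{sl}_{n+1})$ at $q=\varepsilon$ ($K_\mu E_jK_\mu^{-1}=\varepsilon^{(\mu,\alpha_j)}E_j$, $K_\mu F_jK_\mu^{-1}=\varepsilon^{-(\mu,\alpha_j)}F_j$, $[E_i,F_j]=\delta_{ij}(K_{\alpha_i}-K_{\alpha_i}^{-1})/(\varepsilon-\varepsilon^{-1})$,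 Serre), $U_\varepsilon$ the subalgebra with $\mu\in Q$; $\widetilde U_\varepsilon$ is the analogous algebra for $U_q(\widetilde{\mathfrak{sl}}_{n+1})$ with generators $E_i,F_i$ ($i=0,\dots,n$), $K_\mu$ ($\mu\in Q$), $(\mu,\alpha_0)=-(\mu,\theta)$. For $\mathbf b\in\mathbb C^\times$, $\mathrm{ev}^\pm_{\mathbf b}:\widetilde U_\varepsilon\to U'_\varepsilon$ are the homomorphisms fixing $E_i,F_i,K_\mu$ ($i\in I$) with $\mathrm{ev}^+_{\mathbf b}(E_0)=\varepsilon^{-1}\mathbf bK_{\Lambda_1}K_{\Lambda_n}^{-1}[F_n,[F_{n-1},\dots,[F_2,F_1]_{\varepsilon^{-1}}\dots]_{\varepsilon^{-1}}$, $\mathrm{ev}^-_{\mathbf b}(E_0)=\varepsilon^{-1}\mathbf bK_{\Lambda_1}^{-1}K_{\Lambda_n}[F_1,[F_2,\dots,[F_{n-1},F_n]_{\varepsilon^{-1}}\dots]_{\varepsilon^{-1}}$, $\mathrm{ev}^+_{\mathbf b}(F_0)=(-1)^{n-1}\varepsilon^n\mathbf b^{-1}K_{\Lambda_1}^{-1}K_{\Lambda_n}[E_n,[E_{n-1},\dots,[E_2,E_1]_{\varepsilon^{-1}}\dots]_{\varepsilon^{-1}}$, $\mathrm{ev}^-_{\mathbf b}(F_0)=(-1)^{n-1}\varepsilon^n\mathbf b^{-1}K_{\Lambda_1}K_{\Lambda_n}^{-1}[E_1,[E_2,\dots,[E_{n-1},E_n]_{\varepsilon^{-1}}\dots]_{\varepsilon^{-1}}$.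 Put $\mathbf a^\lambda_+=\mathbf a\varepsilon^{-\lambda_{\Lambda_1}+\lambda_{\Lambda_n}+n}$, $\mathbf a^\lambda_-=\mathbf a(-1)^{n+1}\varepsilon^{\lambda_{\Lambda_1}-\lambda_{\Lambda_n}+2n+1}$. Schnizer module: $V_N$ has basis $v(m)$, $m=(m_{ij})_{1\le i\le j\le n}\in\{0,\dots,l-1\}^N$, with $v(m+lm')=v(m)$ for $m'\in\mathbb Z^N$. $\epsilon_{ij}$ is the unit vector at $(i,j)$; $\alpha_{i,j}=\sum_{k=j+1}^i\epsilon_{k-1,n-i+k}-\sum_{k=j}^i\epsilon_{k,n-i+k}$ ($j\le i$). For $c\in\mathbb C^N$ ($c_{ij}=0$ outside $1\le i\le j\le n$): $M_{i,j}(c)=\sum_{k=i-1}^{j-1}(c_{i,k}-c_{i-1,k})+\sum_{k=i}^j(c_{i,k}-c_{i+1,k})$, $N_{i,j}(c)=c_{j-1,n-i+j}-c_{j,n-i+j}$, $\mu_i(c)=\sum_{k=i-1}^nc_{i-1,k}-2\sum_{k=i}^nc_{i,k}+\sum_{k=i+1}^nc_{i+1,k}$; for $c\in\mathbb Z^N$, $a(c)=\prod a_{ij}^{c_{ij}}$. $\rho=\rho(a,b,\lambda):U'_\varepsilon\to\mathrm{End}(V_N)$ is the representation $E_iv(m)=\sum_{j=1}^ia(\alpha_{i,j})[N_{i,j}(m+b)]_\varepsilon v(m+\alpha_{i,j})$, $F_iv(m)=\sum_{j=i}^na_{i,j}[M_{i,j}(m+b)-\lambda_i]_\varepsilon v(m+\epsilon_{i,j})$,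 $K_{\alpha_i}v(m)=\varepsilon^{\mu_i(m+b)+\lambda_i}v(m)$, $K_{\Lambda_i}v(m)=\varepsilon^{-\sum_{k=i}^n(m_{ik}+b_{ik})+\lambda_{\Lambda_i}}v(m)$. Index sets: for $s\in I$, $R_s=\{r^s=(r^s_k)_{k\in I}\in I^n: r^s_1\ge\dots\ge r^s_{s-1}\ge r^s_s<r^s_{s+1}<\dots<r^s_n\}$, $R^F_s=\{r^s\in R_s: k\le r^s_k\le n\ \forall k\}$, $R^E_s=\{r^s\in R_s:1\le r^s_k\le k\ \forall k\}$, $R^F=\bigsqcup_sR^F_s$, $R^E=\bigsqcup_sR^E_s$ (here $s$ is part of the data of $r^s$). $\epsilon_{r^s}=\sum_k\epsilon_{k,r^s_k}$, $\alpha_{r^s}=\sum_k\alpha_{k,r^s_k}$. With $r^s_0:=n$: $C_E(c,r^s)=c_{s-1,s-1}+\sum_{k=1}^{s-1}\sum_{p=r^s_{k+1}}^{r^s_k-1}c_{k,p}-\sum_{k=1}^s\sum_{p=r^s_k+1}^{r^s_{k-1}}c_{k,p}$ for $r^s\in R^F_s$, and $D_F(c,r^s)=-c_{n,n}+\sum_{k=1}^{n-s+1}c_{1,k}-\sum_{k=s+1}^n(c_{r^s_k-1,n-k+r^s_k}-c_{r^s_k,n-k+r^s_k})$ for $r^s\in R^E_s$. *)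

(* Defs.v *)
From HB Require Import structures.
From mathcomp Require Import all_boot all_order all_algebra.
From mathcomp Require Import all_classical all_reals.
From mathcomp Require Import all_analysis.
From mathcomp Require Import complex.
Set Implicit Arguments. Unset Strict Implicit. Unset Printing Implicit Defensive.
Import Order.TTheory GRing.Theory Num.Theory.
Local Open Scope ring_scope.

Section Schnizer.
Variable R : realType.
Local Notation C := (R[i]).

Definition cexp (z : C) : C :=
  let: Complex x y := z in
  (Complex (expR x) 0) * (Complex (cos y) (sin y)).

(* eps^c := exp (c * L), L a fixed logarithm of eps *)
Variable L : C.
Definition qpow (c : C) : C := cexp (c * L).
Definition qint (c : C) : C := (qpow c - qpow (- c)) / (qpow 1 - qpow (-1)).

Variable n l : nat.

Definition inrange (i j : nat) : bool := [&& 0 < i, i <= j & j <= n]%N.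

Definition ent (c : nat -> nat -> C) (i j : nat) : C :=
  if inrange i j then c i j else 0.
Definition enti (c : nat -> nat -> int) (i j : nat) : int :=
  if inrange i j then c i j else 0.

Definition evec (i j : nat) : nat -> nat -> int :=
  fun p q => ((p == i) && (q == j))%:R.
Definition addA (c d : nat -> nat -> int) : nat -> nat -> int := fun p q => c p q + d p q.
Definition sumA (k0 k1 : nat) (f : nat -> nat -> nat -> int) : nat -> nat -> int :=
  fun p q => \sum_(k0 <= k < k1) f k p q.
Definition alphaij (i j : nat) : nat -> nat -> int :=
  fun p q => \sum_(j.+1 <= k < i.+1) evec k.-1 (n - i + k)%N p q
           - \sum_(j <= k < i.+1) evec k (n - i + k)%N p q.

Definition mplusb (m : nat -> nat -> int) (b : nat -> nat -> C) : nat -> nat -> C :=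
  fun i j => (m i j)%:~R + b i j.

Definition Mij (c : nat -> nat -> C) (i j : nat) : C :=
  \sum_(i.-1 <= k < j) (ent c i k - ent c i.-1 k)
  + \sum_(i <= k < j.+1) (ent c i k - ent c i.+1 k).
Definition Nij (c : nat -> nat -> C) (i j : nat) : C :=
  ent c j.-1 (n - i + j)%N - ent c j (n - i + j)%N.
Definition mui (c : nat -> nat -> C) (i : nat) : C :=
  \sum_(i.-1 <= k < n.+1) ent c i.-1 k - 2 * \sum_(i <= k < n.+1) ent c i k
  + \sum_(i.+1 <= k < n.+1) ent c i.+1 k.

(* (Lambda_i, Lambda_j) and lambda_{Lambda_i} *)
Definition LL (i j : nat) : C :=
  ((minn i j * (n.+1 - maxn i j)%N)%:R) / (n.+1)%:R.
Definition lamL (lam : nat -> C) (i : nat) : C := \sum_(1 <= j < n.+1) lam j * LL i j.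
Definition lams (lam : nat -> C) (s : nat) : C :=
  \sum_(1 <= k < s) lam k - \sum_(s.+1 <= k < n.+1) lam k.

Definition apow (a : nat -> nat -> C) (c : nat -> nat -> int) : C :=
  \prod_(1 <= i < n.+1) \prod_(i <= j < n.+1) a i j ^ c i j.

Definition idx := {p : 'I_n * 'I_n | (p.1 <= p.2)%N}.
Definition lab := {ffun idx -> 'Z_l}.
Definition vec := {ffun lab -> C}.

Definition idxof (i j : nat) : option idx :=
  match insub i.-1, insub j.-1 with
  | Some i', Some j' => insub (i', j')
  | _, _ => None
  end.

(* the label of v(m) (entries reduced mod l, v(m + l m') = v(m)) *)
Definition labof (m : nat -> nat -> int) : lab :=
  [ffun p : idx => ((m (val p).1.+1 (val p).2.+1)%:~R : 'Z_l)].
Definition rep (beta : lab) : nat -> nat -> int :=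
  fun i j => if (0 < i)%N then if idxof i j is Some p then (val (beta p) : nat)%:Z else 0
             else 0.

Definition bv (m : nat -> nat -> int) : vec := [ffun beta => ((beta == labof m)%:R : C)].

Definition op := vec -> vec.
Definition ofbasis (act : (nat -> nat -> int) -> vec) : op :=
  fun f => \sum_(beta : lab) f beta *: act (rep beta).

Variables (a b : nat -> nat -> C) (lam : nat -> C).

Definition actE (i : nat) (m : nat -> nat -> int) : vec :=
  \sum_(1 <= j < i.+1)
     (apow a (alphaij i j) * qint (Nij (mplusb m b) i j)) *: bv (addA m (alphaij i j)).
Definition actF (i : nat) (m : nat -> nat -> int) : vec :=
  \sum_(i <= j < n.+1)
     (ent a i j * qint (Mij (mplusb m b) i j - lam i)) *: bv (addA m (evec i j)).
Definition actKa (i : nat) (m : nat -> nat -> int) : vec :=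
  qpow (mui (mplusb m b) i + lam i) *: bv m.
Definition KLexp (i : nat) (m : nat -> nat -> int) : C :=
  - (\sum_(i <= k < n.+1) ent (mplusb m b) i k) + lamL lam i.
Definition actKL (i : nat) (m : nat -> nat -> int) : vec := qpow (KLexp i m) *: bv m.
Definition actKLinv (i : nat) (m : nat -> nat -> int) : vec := qpow (- KLexp i m) *: bv m.
Definition actKainv (i : nat) (m : nat -> nat -> int) : vec :=
  qpow (- (mui (mplusb m b) i + lam i)) *: bv m.

(* expressions in U'_eps (words in the generators), and rho on them *)
Inductive uexp : Type :=
  | UE of nat | UF of nat
  | UKa of nat | UKainv of nat
  | UKL of nat | UKLinv of nat
  | USc of C | UAdd of uexp & uexp | UMul of uexp & uexp.

Fixpoint rho (x : uexp) : op :=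
  match x with
  | UE i => ofbasis (actE i)
  | UF i => ofbasis (actF i)
  | UKa i => ofbasis (actKa i)
  | UKainv i => ofbasis (actKainv i)
  | UKL i => ofbasis (actKL i)
  | UKLinv i => ofbasis (actKLinv i)
  | USc c => fun f => c *: f
  | UAdd x y => fun f => rho x f + rho y f
  | UMul x y => fun f => rho x (rho y f)
  end.

Definition qcomm (x : C) (u v : uexp) : uexp :=
  UAdd (UMul u v) (UMul (USc (- x)) (UMul v u)).

Fixpoint nestDown (x : C) (g : nat -> uexp) (k : nat) : uexp :=
  match k with
  | 0 => g 1
  | 1 => g 1
  | k'.+1 => qcomm x (g k) (nestDown x g k')
  end.
(* [G_{n-d}, [G_{n-d+1}, ..., [G_{n-1}, G_n]_x ...]_x ; use d = n - 1 *)
Fixpoint nestUp (x : C) (g : nat -> uexp) (d : nat) : uexp :=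
  match d with
  | 0 => g n
  | d'.+1 => qcomm x (g (n - d)%N) (nestUp x g d')
  end.

Inductive agen : Type := AE of nat | AF of nat | AKa of nat.

Definition prodU (f : nat -> uexp) (k0 k1 : nat) : uexp :=
  foldr (fun k acc => UMul (f k) acc) (USc 1) (iota k0 (k1 - k0)%N).

(* ev^{+}_bb (pm = true) and ev^{-}_bb (pm = false) *)
Definition ev (pm : bool) (bb : C) (x : agen) : uexp :=
  let ei := qpow (-1) in
  match x with
  | AE 0 =>
      if pm then UMul (USc (qpow (-1) * bb))
                  (UMul (UKL 1) (UMul (UKLinv n) (nestDown ei UF n)))
      else UMul (USc (qpow (-1) * bb))
                  (UMul (UKLinv 1) (UMul (UKL n) (nestUp ei UF n.-1)))
  | AF 0 =>
      if pm then UMul (USc ((-1) ^+ n.-1 * qpow n%:R * bb^-1))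
                  (UMul (UKLinv 1) (UMul (UKL n) (nestDown ei UE n)))
      else UMul (USc ((-1) ^+ n.-1 * qpow n%:R * bb^-1))
                  (UMul (UKL 1) (UMul (UKLinv n) (nestUp ei UE n.-1)))
  | AE i => UE i
  | AF i => UF i
  | AKa 0 => prodU UKainv 1 n.+1       (* K_{alpha_0} = K_{-theta} *)
  | AKa i => UKa i
  end.

Definition abold (pm : bool) (ab : C) : C :=
  if pm then ab * qpow (- lamL lam 1 + lamL lam n + n%:R)
  else ab * (-1) ^+ n.+1 * qpow (lamL lam 1 - lamL lam n + (2 * n)%N.+1%:R).

Definition tev (pm : bool) (ab : C) (x : agen) : op := rho (ev pm (abold pm ab) x).

(* r : 'I_n -> 'I_n encodes r^s_k = (r (k-1)).+1 for k = 1..n *)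
Definition rv (r : {ffun 'I_n -> 'I_n}) (k : nat) : nat :=
  if (0 < k)%N then (if insub k.-1 is Some i then (r i : nat).+1 else 0) else 0.
Definition inR (s : nat) (r : {ffun 'I_n -> 'I_n}) : bool :=
  [forall k : 'I_n, ((k.+1 < s) ==> (rv r k.+2 <= rv r k.+1))
                 && ((s <= k.+1 < n) ==> (rv r k.+1 < rv r k.+2))]%N.
Definition inRF (s : nat) r : bool :=
  inR s r && [forall k : 'I_n, (k.+1 <= rv r k.+1 <= n)]%N.
Definition inRE (s : nat) r : bool :=
  inR s r && [forall k : 'I_n, (1 <= rv r k.+1 <= k.+1)]%N.

Definition eps_r (r : {ffun 'I_n -> 'I_n}) : nat -> nat -> int :=
  sumA 1 n.+1 (fun k => evec k (rv r k)).
Definition alpha_r (r : {ffun 'I_n -> 'I_n}) : nat -> nat -> int :=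
  sumA 1 n.+1 (fun k => alphaij k (rv r k)).

Definition rv0 r (k : nat) : nat := if k == 0 then n else rv r k.

Definition CE (c : nat -> nat -> C) (s : nat) r : C :=
  ent c s.-1 s.-1
  + \sum_(1 <= k < s) \sum_(rv0 r k.+1 <= p < rv0 r k) ent c k p
  - \sum_(1 <= k < s.+1) \sum_((rv0 r k).+1 <= p < (rv0 r k.-1).+1) ent c k p.

Definition DF (c : nat -> nat -> C) (s : nat) r : C :=
  - ent c n n + \sum_(1 <= k < (n - s)%N.+2) ent c 1 k
  - \sum_(s.+1 <= k < n.+1)
       (ent c (rv r k).-1 (n - k + rv r k)%N - ent c (rv r k) (n - k + rv r k)%N).

Definition sgnC (pm : bool) : C := if pm then 1 else -1.

Definition E0rhs (pm : bool) (ab : C) (m : nat -> nat -> int) : vec :=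
  ab *: \sum_(1 <= s < n.+1) \sum_(r : {ffun 'I_n -> 'I_n} | inRF s r)
    ((-1) ^+ (s + n)%N * apow a (eps_r r)
     * qpow (sgnC pm * (CE (mplusb m b) s r - lams lam s - s%:R) + n%:R)
     * qint (- (enti m s.-1 s.-1)%:~R + (enti m s s)%:~R
             - ent b s.-1 s.-1 + ent b s s - lam s))
    *: bv (addA m (eps_r r)).

Definition F0rhs (pm : bool) (ab : C) (m : nat -> nat -> int) : vec :=
  ab^-1 *: \sum_(1 <= s < n.+1) \sum_(r : {ffun 'I_n -> 'I_n} | inRE s r)
    ((-1) ^+ s.-1 * apow a (alpha_r r)
     * qpow (sgnC pm * (DF (mplusb m b) s r - s%:R + n%:R + 1) - n%:R)
     * qint (- (enti m 1 (n - s)%N.+1)%:~R - ent b 1 (n - s)%N.+1))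
    *: bv (addA m (alpha_r r)).

End Schnizer.

(* Main.v *)
Require Import Defs.
From HB Require Import structures.
From mathcomp Require Import all_boot all_order all_algebra.
From mathcomp Require Import all_classical all_reals all_analysis.
From mathcomp Require Import complex.
From mathcomp Require Import ring zify.
Set Implicit Arguments. Unset Strict Implicit. Unset Printing Implicit Defensive.
Import Order.TTheory GRing.Theory Num.Theory.
Local Open Scope ring_scope.

(** Up to Cartan factors, E_0 and F_0 act by nested q-commutators of operators
    [G_k v(m) = \sum_j g_kj [w_kj(m)] v(m + delta_kj)].  For the F's and for the
    E's alike, the summands [j] of [G_k.+1] and [i] of [G_k] shift each other's
    exponents in complementary cases: either [w_k.+1,j] drops by 1 (when
    [i < j]) or [w_k,i] does (when [j <= i]).  Since
    [[w - 1] - eps^-1 [w] = - eps^-w] and [[w] - eps^-1 [w - 1] = eps^(w-1)],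
    each commutator turns one quantum integer into a power of eps, and the terms
    of an ascent followed by a descent cancel.  What survives are the sequences
    that first descend and then ascend, i.e. R_s, with a single quantum integer
    left at the turning point s.  The exponents are then compared by telescoping. *)

(** * Powers of eps and two identities for quantum integers *)

Section QuantumNumbers.
Variables (R : realType) (L : R[i]).
Local Notation C := (R[i]).
Local Notation qpow := (qpow L).
Local Notation qint := (qint L).

Lemma cexpD (z w : C) : cexp (z + w) = cexp z * cexp w.
Proof.
case: z => x y; case: w => x' y'; rewrite /cexp /= expRD cosD sinD.
by apply/eqP; rewrite eq_complex /=; apply/andP; split; apply/eqP; ring.
Qed.

Lemma cexp0 : cexp (0 : C) = 1.
Proof.
apply/eqP; rewrite eq_complex /= expR0 cos0 sin0.
by rewrite !mulr0 !mul0r mulr1 subr0 addr0; apply/andP; split; apply/eqP.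
Qed.

Lemma qpow0 : qpow 0 = 1.
Proof. by rewrite /Defs.qpow mul0r cexp0. Qed.

Lemma qpowD c d : qpow (c + d) = qpow c * qpow d.
Proof. by rewrite /Defs.qpow mulrDl cexpD. Qed.

Lemma qpow_neq0 c : qpow c != 0.
Proof.
apply/eqP => c0; have /eqP := oner_neq0 C; apply.
by rewrite -qpow0 -[X in qpow X](subrr c) qpowD c0 mul0r.
Qed.

Lemma qpowN c : qpow (- c) = (qpow c)^-1.
Proof.
apply: (mulfI (qpow_neq0 c)).
by rewrite -qpowD subrr qpow0 mulfV ?qpow_neq0.
Qed.

Lemma qpow_sum (I : Type) (r : seq I) (P : pred I) (F : I -> C) :
  qpow (\sum_(i <- r | P i) F i) = \prod_(i <- r | P i) qpow (F i).
Proof. exact: (big_morph _ qpowD qpow0). Qed.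

Lemma qpow_nat k : qpow k%:R = qpow 1 ^+ k.
Proof.
elim: k => [|k IHk]; first by rewrite qpow0 expr0.
by rewrite -natr1 qpowD IHk exprSr.
Qed.

(** Exponents matter only modulo l; this makes the actions compatible with labels in ['Z_l]. *)
Lemma qpow_period (l : nat) (z : int) : qpow 1 ^+ l = 1 ->
  qpow (l%:Z * z)%:~R = 1.
Proof.
move=> ql1; have qn k : qpow (l * k)%:R = 1.
  by rewrite qpow_nat exprM ql1 expr1n.
case: z => k; first by rewrite -PoszM -pmulrn qn.
by rewrite NegzE mulrN mulrNz qpowN -PoszM -pmulrn qn invr1.
Qed.

Hypothesis q_neq : qpow 1 - qpow (-1) != 0.

Lemma qint_subl w : qint (w - 1) - qpow (-1) * qint w = - qpow (- w).
Proof.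
have := q_neq; rewrite /Defs.qint opprB !qpowD !qpowN => q_neq'.
have := qpow_neq0 1; have := qpow_neq0 w.
set x := qpow w; set q := qpow 1 in q_neq' *.
move=> x0 q0; have qq_neq : q * q - 1 != 0.
  by have -> : q * q - 1 = (q - q^-1) * q; [field | rewrite mulf_neq0].
by field; rewrite x0 q0 qq_neq.
Qed.

Lemma qint_subr w : qint w - qpow (-1) * qint (w - 1) = qpow (w - 1).
Proof.
have := q_neq; rewrite /Defs.qint opprB !qpowD !qpowN => q_neq'.
have := qpow_neq0 1; have := qpow_neq0 w.
set x := qpow w; set q := qpow 1 in q_neq' *.
move=> x0 q0; have qq_neq : q * q - 1 != 0.
  by have -> : q * q - 1 = (q - q^-1) * q; [field | rewrite mulf_neq0].
by field; rewrite x0 q0 qq_neq.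
Qed.

End QuantumNumbers.

(** * Sums over finite sequences, one entry at a time *)

Section PrefixSums.
Variables (V : nmodType) (T : finType) (t0 : T).

Definition upd (r : nat -> T) (k : nat) (j : T) : nat -> T :=
  fun i => if i == k then j else r i.

(** A default value past the end lets sequences of different lengths be compared as functions on
    [nat]. *)
Definition ext0 K (f : {ffun 'I_K -> T}) : nat -> T :=
  fun i => if insub i is Some i' then f i' else t0.

(** A sequence is a prefix with a last entry attached; this drives the induction on the depth of the
    nested commutator. *)
Lemma sum_ffun_recr K (F : (nat -> T) -> V) :
  \sum_(f : {ffun 'I_K.+1 -> T}) F (ext0 f)
  = \sum_(f : {ffun 'I_K -> T}) \sum_j F (upd (ext0 f) K j).
Proof.
rewrite pair_big /=.
pose h (p : {ffun 'I_K -> T} * T) : {ffun 'I_K.+1 -> T} :=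
  [ffun i => if unlift ord_max i is Some i' then p.1 i' else p.2].
rewrite (reindex h) /=; last first.
  exists (fun f : {ffun 'I_K.+1 -> T} =>
    ([ffun i => f (lift ord_max i)], f ord_max)) => [[f j] _ | f _].
    rewrite /h /= ffunE unlift_none; congr pair.
    by apply/ffunP => i; rewrite !ffunE liftK.
  apply/ffunP => i; rewrite ffunE.
  by case: unliftP => [i' ->|->] //=; rewrite ffunE.
apply: eq_bigr => -[f j] _ /=; congr F; apply: funext => i.
rewrite /ext0 /upd; case: insubP => [i' lti <-|].
  rewrite /h ffunE; case: unliftP => [k ->|->] /=; last by rewrite eqxx.
  (* [bump K] moves only values from K on, so the lift of k < K is k itself. *)
  have -> : bump K k = k by rewrite /bump leqNgt ltn_ord.
  by rewrite ltn_eqF // insubT //= => ltk; congr (f _); apply: val_inj.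
rewrite -leqNgt => leKi; rewrite gtn_eqF // insubF //.
by apply/negbTE; rewrite -leqNgt ltnW.
Qed.

End PrefixSums.

(** * Linear maps given as plain functions *)

Section Linear.
Variables (C : pzRingType) (U V : lmodType C) (h : U -> V).
Hypothesis h_lin : forall c f g, h (c *: f + g) = c *: h f + h g.

(** The operators of the module are bare functions, so linearity is carried as an equation and
    extended to sums here. *)
Lemma lin_sum (I : Type) (r : seq I) (P : pred I) (c : I -> C) (f : I -> U) :
  h (\sum_(i <- r | P i) c i *: f i) = \sum_(i <- r | P i) c i *: h (f i).
Proof.
have h0 : h 0 = 0.
  by apply: (addIr (h 0)); rewrite add0r -{1}[h 0]scale1r -h_lin scaler0 add0r.
elim: r => [|i r IHr]; first by rewrite !big_nil.
by rewrite !big_cons; case: ifP => // _; rewrite h_lin IHr.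
Qed.

Lemma lin_scale c f : h (c *: f) = c *: h f.
Proof.
have := @lin_sum unit [:: tt] xpredT (fun=> c) (fun=> f).
by rewrite !big_seq1.
Qed.

End Linear.

(** * Nested q-commutators of operators that shift a basis *)

Section NestedCommutator.
Variables (R : realType) (L : R[i]).
Local Notation C := (R[i]).
Local Notation qpow := (qpow L).
Local Notation qint := (qint L).
Hypothesis q_neq : qpow 1 - qpow (-1) != 0.
Variables (V : lmodType C) (M : zmodType) (v : M -> V).

(** The operator form of both [nestDown] and [nestUp]: [G 0] is innermost, and the enumeration [G]
    fixes the direction. *)
Fixpoint nest (G : nat -> V -> V) (k : nat) : V -> V :=
  match k with
  | 0 => G 0%N
  | k'.+1 => fun f => G k (nest G k' f) - qpow (-1) *: nest G k' (G k f)
  end.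

Lemma nest_lin G : (forall k c f g, G k (c *: f + g) = c *: G k f + G k g) ->
  forall k c f g, nest G k (c *: f + g) = c *: nest G k f + nest G k g.
Proof.
move=> Glin; elim=> [|k IHk] c f g //=.
rewrite !IHk !Glin IHk !scalerDr scalerN !scalerA mulrC opprD addrACA.
by [].
Qed.

Variables (T : finType) (t0 : T) (n : nat).
Variables (G : nat -> V -> V) (g : nat -> T -> C) (w : nat -> T -> M -> C).
(* [lt] is [<] for the nesting that starts at index 1, and [<=] for the one that
   starts at index n and so meets the sequence backwards. *)
Variables (delta : nat -> T -> M) (lt : rel T).
Hypothesis G_lin : forall k c f h, G k (c *: f + h) = c *: G k f + G k h.
Hypothesis G_v : forall k m, (k < n)%N ->
  G k (v m) = \sum_j (g k j * qint (w k j m)) *: v (m + delta k j).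
(** The shift rules are asked only where the coefficients are nonzero: sums run over all of [T], and
    [g] is to vanish at indices outside the intended range. *)
Hypothesis w_next : forall k i j m, (k.+1 < n)%N -> g k i != 0 -> g k.+1 j != 0 ->
  w k.+1 j (m + delta k i) = w k.+1 j m - (lt i j)%:R.
Hypothesis w_prev : forall k i j m, (k.+1 < n)%N -> g k i != 0 -> g k.+1 j != 0 ->
  w k i (m + delta k.+1 j) = w k i m - (~~ lt i j)%:R.
Hypothesis w_far : forall k k' i j m, (k.+1 < k')%N -> (k' < n)%N ->
  g k i != 0 -> g k' j != 0 ->
  w k' j (m + delta k i) = w k' j m /\ w k i (m + delta k' j) = w k i m.

(** Each eps^(w-1) is the right side of [qint_subr], just as -eps^(-w) in [ascw] is that of
    [qint_subl]. *)
Definition descw (r : nat -> T) s m : C :=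
  \prod_(0 <= i < s) ((~~ lt (r i) (r i.+1))%:R * qpow (w i (r i) m - 1)).
Definition ascw (r : nat -> T) s K m : C :=
  \prod_(s <= i < K) - ((lt (r i) (r i.+1))%:R * qpow (- w i.+1 (r i.+1) m)).
(** At most one [s] contributes, the turning point of [r]: at each step exactly one of the two order
    indicators is nonzero. *)
Definition coef K (r : nat -> T) m : C :=
  \sum_(0 <= s < K.+1) descw r s m * qint (w s (r s) m) * ascw r s K m.
Definition gprod K (r : nat -> T) : C := \prod_(0 <= i < K.+1) g i (r i).
Definition dsum K (r : nat -> T) : M := \sum_(0 <= i < K.+1) delta i (r i).

Lemma eq_descw r r' s m m' :
  (forall i, (i <= s)%N -> r i = r' i) ->
  (forall i, (i < s)%N -> w i (r i) m = w i (r i) m') ->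
  descw r s m = descw r' s m'.
Proof.
move=> rr' ww'; apply: eq_big_nat => i /andP[_ lti].
by rewrite ww' // !rr' // ltnW.
Qed.

Lemma eq_coef r r' K m m' :
  (forall i, (i <= K)%N -> r i = r' i) ->
  (forall i, (i <= K)%N -> w i (r i) m = w i (r i) m') ->
  coef K r m = coef K r' m'.
Proof.
move=> rr' ww'; apply: eq_big_nat => s /andP[_ leK].
rewrite (@eq_descw r r' s m m'); first last.
- by move=> i lti; apply: ww'; lia.
- by move=> i lti; apply: rr'; lia.
rewrite ww' // rr' //; congr (_ * _).
apply: eq_big_nat => i /andP[_ lti].
by rewrite ww' // !rr' // ltnW.
Qed.

(** For a turning point s <= K the new step must be an ascent; the remaining summand has its turning
    point at K+1, with descents only. *)
Lemma coefS K r m : coef K.+1 r m =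
  - ((lt (r K) (r K.+1))%:R * qpow (- w K.+1 (r K.+1) m)) * coef K r m
  + descw r K.+1 m * qint (w K.+1 (r K.+1) m).
Proof.
rewrite /coef big_nat_recr //=; congr (_ + _); last first.
  by rewrite /ascw big_geq // mulr1.
rewrite big_distrr /=; apply: eq_big_nat => s /andP[_ leK].
by rewrite /ascw big_nat_recr //= [RHS]mulrC !mulrA.
Qed.

(* Only the last descending factor sees the shift, so every summand with an ascent
   before position K cancels. *)
Lemma coef_subr K r m m' :
  (forall i, (i < K)%N -> w i (r i) m' = w i (r i) m) ->
  w K (r K) m' = w K (r K) m - 1 ->
  coef K r m - qpow (-1) * coef K r m' = descw r K m * qpow (w K (r K) m - 1).
Proof.
case: K => [_ wK|K ww' wK].
  rewrite /coef !big_nat1 /ascw /descw !big_geq // wK !mul1r !mulr1.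
  exact: qint_subr.
rewrite !coefS wK; have -> : coef K r m' = coef K r m by apply: eq_coef.
have -> : descw r K.+1 m' = descw r K.+1 m by apply: eq_descw.
rewrite -(qint_subr q_neq) opprB [1 - _]addrC qpowD; set x := w _ _ _.
by rewrite !qpowN; field; rewrite !qpow_neq0.
Qed.

Lemma gprod_neq0 K r : gprod K r != 0 -> forall i, (i <= K)%N -> g i (r i) != 0.
Proof.
rewrite /gprod => + i leK; rewrite big_mkord (bigD1 (Ordinal (leK : (i < K.+1)%N))) //=.
by apply: contraNneq => ->; rewrite mul0r.
Qed.

(** Only the shift at the neighbour K is visible at K+1; the earlier ones are at distance at least
    two and drop out by [w_far]. *)
Lemma w_dsum K r m : (K.+1 < n)%N ->
  (forall i, (i <= K.+1)%N -> g i (r i) != 0) ->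
  w K.+1 (r K.+1) (m + dsum K r) = w K.+1 (r K.+1) m - (lt (r K) (r K.+1))%:R.
Proof.
move=> ltn g0; rewrite /dsum big_nat_recr //= addrA w_next ?g0 //; congr (_ - _).
suff H k : (k <= K)%N -> w K.+1 (r K.+1) (m + \sum_(0 <= i < k) delta i (r i))
   = w K.+1 (r K.+1) m by apply: H.
elim: k => [|k IHk] lek; first by rewrite big_geq // addr0.
have ltkK : (k.+1 < K.+1)%N by lia.
have gk : g k (r k) != 0 by apply: g0; lia.
rewrite big_nat_recr //= addrA (w_far _ ltkK ltn gk (g0 _ (leqnn _))).1 IHk //.
exact: ltnW.
Qed.

(** The commutator with [G K.+1], read off at a single sequence. The direction of the last step
    decides which of [w K.+1] and [w K] is shifted. *)
Lemma nest_coef K r m : (K.+1 < n)%N ->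
  gprod K r * g K.+1 (r K.+1) *
   (coef K r m * qint (w K.+1 (r K.+1) (m + dsum K r))
    - qpow (-1) * (qint (w K.+1 (r K.+1) m) * coef K r (m + delta K.+1 (r K.+1))))
  = gprod K.+1 r * coef K.+1 r m.
Proof.
move=> ltn; rewrite {2}/gprod big_nat_recr //= -/(gprod K r).
case: (eqVneq (gprod K r) 0) => [->|g0]; first by rewrite !mul0r.
case: (eqVneq (g K.+1 (r K.+1)) 0) => [->|gK]; first by rewrite !mulr0 !mul0r.
have {}g0 i : (i <= K.+1)%N -> g i (r i) != 0.
  by rewrite leq_eqVlt => /predU1P[->//|ltK]; apply: gprod_neq0 g0 _ _.
congr (_ * _); rewrite w_dsum // coefS.
have far i : (i < K)%N -> w i (r i) (m + delta K.+1 (r K.+1)) = w i (r i) m.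
  move=> lti; have ltiK : (i.+1 < K.+1)%N by [].
  by apply: (w_far _ ltiK ltn _ gK).2; apply: g0; lia.
have prev := w_prev m ltn (g0 _ (leqnSn K)) gK.
rewrite {1}/descw big_nat_recr //= -/(descw r K m).
case: (lt (r K) (r K.+1)) prev => /= prev.
  (* Last step an ascent: [coef K r] is unchanged by the shift, and [qint_subl] removes the new
     quantum integer. *)
  rewrite (eq_coef (r' := r) (m' := m)) //; last first.
    by move=> i; rewrite leq_eqVlt => /predU1P[->|/far //]; rewrite prev subr0.
  rewrite mul1r !mul0r mulr0 mul0r addr0 mulrA -[_ * coef K r m]mulrC -mulrBr mulrC.
  by rewrite (qint_subl q_neq).
(* Last step a descent: the new quantum integer sees no shift and survives, while [coef_subr]
   removes the one in [coef K r]. *)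
rewrite subr0 !mul0r oppr0 !mul0r add0r mul1r -(coef_subr _ prev) //.
by ring.
Qed.

Lemma nest_v K m : (K < n)%N -> nest G K (v m) =
  \sum_(f : {ffun 'I_K.+1 -> T})
    (gprod K (ext0 t0 f) * coef K (ext0 t0 f) m) *: v (m + dsum K (ext0 t0 f)).
Proof.
elim: K m => [|K IHK] m ltn.
  rewrite (sum_ffun_recr t0 _ (fun r => (gprod 0 r * coef 0 r m) *: v (m + dsum 0 r))).
  rewrite exchange_big /= G_v //; apply: eq_bigr => j _.
  rewrite (big_pred1 [ffun=> t0]); last first.
    by move=> f; symmetry; apply/eqP/ffunP => -[].
  rewrite /gprod /coef /dsum /descw /ascw !big_nat1 !big_geq //.
  by rewrite mul1r mulr1 /upd eqxx.
rewrite (sum_ffun_recr t0 _ (fun r => (gprod K.+1 r * coef K.+1 r m) *: v (m + dsum K.+1 r))).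
rewrite /= IHK; last by lia.
rewrite (lin_sum (G_lin K.+1)) G_v // (lin_sum (nest_lin G_lin K)).
under [X in X - _]eq_bigr do rewrite G_v // scaler_sumr.
under [X in _ *: X]eq_bigr do rewrite (IHK _ (ltnW ltn)) scaler_sumr.
(* The second product sums over the last entry first; after the exchange both run over the prefix
   [f] and then over [j]. *)
rewrite [X in _ *: X]exchange_big /= scaler_sumr -sumrB; apply: eq_bigr => f _.
rewrite scaler_sumr -sumrB; apply: eq_bigr => j _.
set r := upd _ _ _.
have rE i : (i <= K)%N -> ext0 t0 f i = r i by rewrite /r /upd; case: eqP => // ->; lia.
have rK : r K.+1 = j by rewrite /r /upd eqxx.
have -> : gprod K (ext0 t0 f) = gprod K r.
  by apply: eq_big_nat => i lti; rewrite rE.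
have -> : dsum K (ext0 t0 f) = dsum K r.
  by apply: eq_big_nat => i lti; rewrite rE.
rewrite !(eq_coef (r := ext0 t0 f) (r' := r) rE (fun _ _ => erefl)).
have -> : dsum K.+1 r = dsum K r + delta K.+1 j by rewrite /dsum big_nat_recr //= rK.
rewrite -nest_coef // rK !scalerA [m + delta _ _ + _]addrAC -addrA -scalerBl.
by congr (_ *: _); ring.
Qed.

End NestedCommutator.

(** * Membership in R_s as a product of order indicators *)

Lemma prodr_bool (R : comPzRingType) (B : nat -> bool) (s : seq nat) :
  \prod_(i <- s) (B i)%:R = (all B s)%:R :> R.
Proof.
elim: s => [|i s IHs]; first by rewrite big_nil.
by rewrite big_cons IHs -natrM mulnb.
Qed.

Section RootSequences.
Variables (n' : nat).
Local Notation n := n'.+1.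
Implicit Type f : {ffun 'I_n -> 'I_n}.

Lemma rvS f k : (k < n)%N -> rv f k.+1 = (ext0 ord0 f k).+1.
Proof. by move=> ltk; rewrite /rv /ext0 insubT. Qed.

(** The turning point is 0-based in the products and 1-based in [inR], hence [s.+1]. *)
Lemma prod_inR (R : comPzRingType) f s (X Y : nat -> R) q : (s <= n')%N ->
  let e := ext0 ord0 f in
  (\prod_(0 <= i < s) ((e i.+1 <= e i)%N%:R * X i)) * q
     * (\prod_(s <= i < n') ((e i < e i.+1)%N%:R * Y i))
  = (inR s.+1 f)%:R * (\prod_(0 <= i < s) X i * q * \prod_(s <= i < n') Y i).
Proof.
move=> les e; rewrite !big_split /= !prodr_bool.
set A := all _ _; set B := all _ _.
suff <- : (A && B) = inR s.+1 f by rewrite -mulnb natrM; ring.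
apply/andP/forallP => [[/allP hA /allP hB] k | h].
  have ltk := ltn_ord k; apply/andP; split; apply/implyP => hk.
    by rewrite !rvS ?ltnS; try lia; apply: (hA (nat_of_ord k)); rewrite mem_index_iota; lia.
  by rewrite !rvS ?ltnS; try lia; apply: (hB (nat_of_ord k)); rewrite mem_index_iota; lia.
split; apply/allP => k; rewrite mem_index_iota => hk.
  have ltk : (k < n)%N by lia.
  have /andP[/implyP h1 _] := h (Ordinal ltk).
  by move: h1; rewrite /= !rvS ?ltnS; try lia; apply; lia.
have ltk : (k < n)%N by lia.
have /andP[_ /implyP h1] := h (Ordinal ltk).
by move: h1; rewrite /= !rvS ?ltnS; try lia; apply; lia.
Qed.

End RootSequences.

(** * Both directions of nesting as sums over R_s *)

Section NestedSums.
Variables (R : realType) (L : R[i]).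
Local Notation C := (R[i]).
Local Notation qpow := (qpow L).
Local Notation qint := (qint L).
Hypothesis q_neq : qpow 1 - qpow (-1) != 0.
Variables (V : lmodType C) (M : zmodType) (v : M -> V) (n : nat).
Variables (Op : nat -> V -> V) (g : nat -> nat -> C) (w : nat -> nat -> M -> C).
Variable delta : nat -> nat -> M.
Hypothesis Op_lin : forall k c f h, Op k (c *: f + h) = c *: Op k f + Op k h.
Hypothesis Op_v : forall k m, (0 < k <= n)%N ->
  Op k (v m) = \sum_(1 <= j < n.+1) (g k j * qint (w k j m)) *: v (m + delta k j).
Hypothesis w_next : forall k i j m, (0 < k)%N -> (k < n)%N ->
  g k i != 0 -> g k.+1 j != 0 ->
  w k.+1 j (m + delta k i) = w k.+1 j m - (i < j)%N%:R.
Hypothesis w_prev : forall k i j m, (0 < k)%N -> (k < n)%N ->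
  g k i != 0 -> g k.+1 j != 0 ->
  w k i (m + delta k.+1 j) = w k i m - (j <= i)%N%:R.
Hypothesis w_far : forall k k' i j m, (0 < k)%N -> (k.+1 < k')%N -> (k' <= n)%N ->
  g k i != 0 -> g k' j != 0 ->
  w k' j (m + delta k i) = w k' j m /\ w k i (m + delta k' j) = w k i m.

(** The exponent of eps collected along a sequence that turns at s, up to a constant, for the
    nesting that starts at index 1; starting at n reverses its sign. *)
Definition wexp (r : {ffun 'I_n -> 'I_n}) s m : C :=
  \sum_(1 <= i < s) w i (rv r i) m - \sum_(s.+1 <= i < n.+1) w i (rv r i) m.

Definition nest_sum (X : nat -> {ffun 'I_n -> 'I_n} -> C) m : V :=
  \sum_(1 <= s < n.+1) \sum_(r : {ffun 'I_n -> 'I_n} | inR s r)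
    ((\prod_(1 <= k < n.+1) g k (rv r k)) * (X s r * qint (w s (rv r s) m)))
      *: v (m + \sum_(1 <= k < n.+1) delta k (rv r k)).

(** The n - s ascents give the sign, and each of the s - 1 descents lowers the exponent by 1. *)
Lemma nest_down m : (0 < n)%N -> nest L (fun k => Op k.+1) n.-1 (v m) =
  nest_sum (fun s r => (-1) ^+ (n - s) * qpow (wexp r s m - s.-1%:R)) m.
Proof.
rewrite /nest_sum /wexp; move: Op_v w_next w_prev w_far.
case: n => // n' OpE next prev far _.
rewrite (@nest_v _ L q_neq _ _ v _ ord0 n'.+1 _ (fun k j => g k.+1 j.+1)
  (fun k j => w k.+1 j.+1) (fun k j => delta k.+1 j.+1)
  (fun i j : 'I_n'.+1 => (i < j)%N)) //.
- rewrite [RHS]big_add1 /=.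
  under eq_bigr do rewrite /coef mulr_sumr scaler_suml.
  rewrite exchange_big /=; apply: eq_big_nat => s /andP[_ les].
  rewrite [RHS]big_mkcond /=; apply: eq_bigr => f _.
  rewrite /descw /ascw.
  under [X in X * _ * _]eq_bigr do rewrite -leqNgt.
  under [X in _ * _ * X]eq_bigr do rewrite -mulrN.
  rewrite prod_inR //; case: (inR s.+1 f); last by rewrite mul0r mulr0 scale0r.
  rewrite mul1r; congr (_ *: v (m + _)); last first.
    by rewrite /dsum [RHS]big_add1; apply: eq_big_nat => i lti; rewrite rvS.
  congr (_ * _).
    by rewrite /gprod [RHS]big_add1; apply: eq_big_nat => i lti; rewrite rvS.
  rewrite rvS // mulrAC; congr (_ * _); rewrite mulrC.
  under [X in X * _ = _]eq_bigr do rewrite -mulN1r.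
  rewrite big_split prodr_const_nat /= subSS -mulrA; congr (_ * _).
  rewrite -!qpow_sum -qpowD; congr Defs.qpow.
  rewrite sumrB sumr_const_nat subn0 sumrN big_add1 /= [X in _ - X - _]big_add1 big_add1 /=.
  rewrite [in RHS](@eq_big_nat _ _ _ 0 s _ (fun i => w i.+1 (ext0 ord0 f i).+1 m)); last first.
    by move=> i lti; rewrite rvS //; lia.
  rewrite [in RHS](@eq_big_nat _ _ _ s n' _ (fun i => w i.+2 (ext0 ord0 f i.+1).+1 m)); last first.
    by move=> i lti; rewrite rvS //; lia.
  by ring.
- by move=> k m' ltk; rewrite OpE // big_add1 /= big_mkord.
- by move=> k i j m' ltk gi gj; rewrite next.
- by move=> k i j m' ltk gi gj; rewrite prev // -leqNgt.
- by move=> k k' i j m' ltk ltk' gi gj; apply: far.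
Qed.

(** Read backwards, a strict ascent is a descent with respect to [<=], so the roles swap: the s - 1
    weak descents give the sign, and each of the n - s ascents lowers the exponent by 1. *)
Lemma nest_up m : (0 < n)%N -> nest L (fun k => Op (n - k)%N) n.-1 (v m) =
  nest_sum (fun s r => (-1) ^+ s.-1 * qpow (- wexp r s m - (n - s)%N%:R)) m.
Proof.
rewrite /nest_sum /wexp; move: Op_v w_next w_prev w_far.
case: n => // n' OpE next prev far _.
rewrite (@nest_v _ L q_neq _ _ v _ ord0 n'.+1 _ (fun k j => g (n'.+1 - k)%N j.+1)
  (fun k j => w (n'.+1 - k)%N j.+1) (fun k j => delta (n'.+1 - k)%N j.+1)
  (fun i j : 'I_n'.+1 => (i <= j)%N)) //.
- rewrite [RHS]big_add1 /=.
  (* Reversing the sequences undoes the enumeration by n - k; the 0-based turning point s becomes n'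
     - s. *)
  pose rv' (f : {ffun 'I_n'.+1 -> 'I_n'.+1}) := [ffun i => f (rev_ord i)].
  have rv'K : involutive rv'.
    by move=> f; apply/ffunP => i; rewrite !ffunE rev_ordK.
  rewrite (reindex_inj (inv_inj rv'K)) /=.
  have ext_rv' f i : (i <= n')%N -> ext0 ord0 (rv' f) i = ext0 ord0 f (n' - i)%N.
    move=> lei; rewrite /ext0 !insubT //= => [|h]; first by rewrite ltnS leq_subr.
    by rewrite ffunE; congr (f _); apply: val_inj; rewrite /= subSS.
  under eq_bigr do rewrite /coef mulr_sumr scaler_suml.
  rewrite exchange_big /= big_nat_rev /= add0n; apply: eq_big_nat => s /andP[_ les].
  rewrite [RHS]big_mkcond /=; apply: eq_bigr => f _.
  rewrite subSS.
  have -> : descw L (fun k (j : 'I_n'.+1) => w (n'.+1 - k)%N j.+1)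
      (fun i j : 'I_n'.+1 => (i <= j)%N) (ext0 ord0 (rv' f)) (n' - s) m
    = \prod_(s <= i < n') ((ext0 ord0 f i < ext0 ord0 f i.+1)%N%:R
         * qpow (w i.+2 (ext0 ord0 f i.+1).+1 m - 1)).
    rewrite -{2}[s]add0n big_addn [RHS]big_nat_rev; apply: eq_big_nat => i lti.
    rewrite !ext_rv' -?ltnNge; try lia.
    have -> : (0 + (n' - s) - i.+1 + s = n' - i.+1)%N by lia.
    have -> : ((n' - i.+1).+1 = n' - i)%N by lia.
    by have -> : ((n' - i).+1 = n'.+1 - i)%N by lia.
  have -> : ascw L (fun k (j : 'I_n'.+1) => w (n'.+1 - k)%N j.+1)
      (fun i j : 'I_n'.+1 => (i <= j)%N) (ext0 ord0 (rv' f)) (n' - s) n' m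
    = \prod_(0 <= i < s) ((ext0 ord0 f i.+1 <= ext0 ord0 f i)%N%:R
         * - qpow (- w i.+1 (ext0 ord0 f i).+1 m)).
    rewrite /ascw -{1}[(n' - s)%N]add0n big_addn subKn // big_nat_rev /=.
    apply: eq_big_nat => i lti; rewrite mulrN.
    have -> : (0 + s - i.+1 + (n' - s) = n' - i.+1)%N by lia.
    rewrite !ext_rv'; try lia.
    have -> : (n' - (n' - i.+1).+1 = i)%N by lia.
    have -> : (n' - (n' - i.+1) = i.+1)%N by lia.
    by have -> : (n'.+1 - (n' - i.+1).+1 = i.+1)%N by lia.
  rewrite [_ * _ * \prod_(0 <= i < s) _]mulrC [_ * qint _]mulrC mulrA prod_inR //.
  case: (inR s.+1 f); last by rewrite mul0r mulr0 scale0r.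
  rewrite mul1r; congr (_ *: v (m + _)); last first.
    rewrite /dsum [RHS]big_add1 [RHS]big_nat_rev; apply: eq_big_nat => i lti.
    rewrite /= ext_rv' //.
    have -> : ((0 + n'.+1 - i.+1).+1 = n'.+1 - i)%N by lia.
    by rewrite subSn // rvS //; lia.
  congr (_ * _).
    rewrite /gprod [RHS]big_add1 [RHS]big_nat_rev; apply: eq_big_nat => i lti.
    rewrite /= ext_rv' //.
    have -> : ((0 + n'.+1 - i.+1).+1 = n'.+1 - i)%N by lia.
    by rewrite subSn // rvS //; lia.
  rewrite ext_rv' ?leq_subr // subKn // subSn ?leq_subr // subKn //.
  rewrite rvS // mulrAC; congr (_ * _).
  under [X in X * _ = _]eq_bigr do rewrite -mulN1r.
  rewrite big_split prodr_const_nat /= subn0 -mulrA; congr (_ * _).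
  rewrite -!qpow_sum -qpowD; congr Defs.qpow.
  rewrite sumrB sumr_const_nat sumrN big_add1 /= [X in - (_ - X) - _]big_add1 big_add1 /=.
  rewrite [in RHS](@eq_big_nat _ _ _ 0 s _ (fun i => w i.+1 (ext0 ord0 f i).+1 m)); last first.
    by move=> i lti; rewrite rvS //; lia.
  rewrite [in RHS](@eq_big_nat _ _ _ s n' _ (fun i => w i.+2 (ext0 ord0 f i.+1).+1 m)); last first.
    by move=> i lti; rewrite rvS //; lia.
  by ring.
- by move=> k m' ltk; rewrite OpE ?big_add1 /= ?big_mkord //; lia.
- move=> k i j m' ltk gi gj; have E : (n'.+1 - k = (n'.+1 - k.+1).+1)%N by lia.
  by rewrite E prev -?E //; lia.
- move=> k i j m' ltk gi gj; have E : (n'.+1 - k = (n'.+1 - k.+1).+1)%N by lia.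
  by rewrite {1 2}E next -?E -?ltnNge //; lia.
- move=> k k' i j m' ltk ltk' gi gj.
  by have [|||-> ->] := far _ _ _ _ m' _ _ _ gj gi; first [lia | split].
Qed.

End NestedSums.

(** * The module V_N: dependence on m modulo l *)

Lemma Zp_int_eq (l : nat) (x y : int) : (1 < l)%N ->
  (x%:~R : 'Z_l) = y%:~R -> exists z, x = y + l%:Z * z.
Proof.
move=> l1 exy; suff [z xyz] : exists z, x - y = l%:Z * z.
  by exists z; rewrite -xyz addrC subrK.
have : ((x - y)%:~R : 'Z_l) = 0 by rewrite intrB exy subrr.
have nat_eq k : (k%:R : 'Z_l) = 0 -> exists z, k%:Z = l%:Z * z.
  (* The bound l > 1 ensures that the modulus of ['Z_l] is l itself. *)
  move/(congr1 val) => /=; rewrite val_Zp_nat // => /eqP/dvdnP[q ->].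
  by exists q%:Z; rewrite PoszM mulrC.
case: (x - y) => k; first by rewrite -pmulrn => /nat_eq.
rewrite NegzE mulrNz => /eqP; rewrite oppr_eq0 -pmulrn => /eqP/nat_eq[z kz].
by exists (- z); rewrite kz mulrN.
Qed.

Section Module.
Variables (R : realType) (L : R[i]) (n l : nat).
Local Notation C := (R[i]).
Local Notation qpow := (qpow L).
Local Notation qint := (qint L).
Hypothesis l_gt1 : (1 < l)%N.
Hypothesis ql : qpow 1 ^+ l = 1.

(** The entries of m + b are complex, so congruence modulo l is taken in C: the difference is an
    integer multiple of l. *)
Definition cong (x y : C) := exists z : int, x = y + (l%:Z * z)%:~R.

Lemma cong_refl x : cong x x.
Proof. by exists 0; rewrite mulr0 addr0. Qed.

Lemma congD x x' y y' : cong x x' -> cong y y' -> cong (x + y) (x' + y').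
Proof.
by move=> [z ->] [t ->]; exists (z + t); rewrite mulrDr intrD addrACA.
Qed.

Lemma congN x x' : cong x x' -> cong (- x) (- x').
Proof. by move=> [z ->]; exists (- z); rewrite mulrN mulrNz opprD. Qed.

Lemma congB x x' y y' : cong x x' -> cong y y' -> cong (x - y) (x' - y').
Proof. by move=> xx' yy'; apply: congD xx' (congN yy'). Qed.

Lemma cong_sum (I : Type) (r : seq I) (P : pred I) (F F' : I -> C) :
  (forall i, cong (F i) (F' i)) ->
  cong (\sum_(i <- r | P i) F i) (\sum_(i <- r | P i) F' i).
Proof. by move=> FF'; apply: (big_ind2 cong) => // [|*]; [apply: cong_refl | apply: congD]. Qed.

Lemma qpow_cong x y : cong x y -> qpow x = qpow y.
Proof. by case=> z ->; rewrite qpowD qpow_period // mulr1. Qed.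

Lemma qint_cong x y : cong x y -> qint x = qint y.
Proof. by move=> xy; rewrite /Defs.qint (qpow_cong xy) (qpow_cong (congN xy)). Qed.

Local Notation idx := (idx n).
Local Notation labof := (@labof n l).
Local Notation bv := (bv R n l).

Lemma idxofK (p : idx) : idxof n (val p).1.+1 (val p).2.+1 = Some p.
Proof. by rewrite /idxof /= !valK -surjective_pairing valK. Qed.

Lemma labof_rep (beta : lab n l) : labof (rep beta) = beta.
Proof.
apply/ffunP => p; rewrite ffunE /rep /= idxofK -pmulrn.
exact: natr_Zp.
Qed.

Lemma labof_ent b m m' i j : labof m = labof m' ->
  cong (ent n (mplusb m b) i j) (ent n (mplusb m' b : nat -> nat -> C) i j).
Proof.
rewrite /ent; case: ifP => [/and3P[i0 lij ljn] mm'|_ _]; last exact: cong_refl.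
have hi : (i.-1 < n)%N by lia.
have hj : (j.-1 < n)%N by lia.
have hij : (Ordinal hi <= Ordinal hj)%N by rewrite /=; lia.
have := congr1 (fun f : lab n l => f (exist _ (Ordinal hi, Ordinal hj) hij)) mm'.
rewrite !ffunE /= !prednK //; last by lia.
move=> /(Zp_int_eq l_gt1)[z mz].
by exists z; rewrite /mplusb mz intrD addrAC.
Qed.

Lemma bv_eq m m' : labof m = labof m' -> bv m = bv m'.
Proof. by rewrite /Defs.bv => ->. Qed.

Lemma labof_add m m' d : labof m = labof m' -> labof (Defs.addA m d) = labof (Defs.addA m' d).
Proof.
move=> mm'; apply/ffunP => p; rewrite !ffunE /Defs.addA !intrD; congr (_ + _).
by have := congr1 (fun f : lab n l => f p) mm'; rewrite !ffunE.
Qed.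

(** [ofbasis] evaluates an action only at the reduced representative of a label; the formula at a
    general m holds because the action depends on residues alone. *)
Lemma ofbasis_bv (act : (nat -> nat -> int) -> vec R n l) m :
  (forall m', labof m' = labof m -> act m' = act m) -> ofbasis act (bv m) = act m.
Proof.
move=> actP; rewrite /ofbasis (bigD1 (labof m)) //= big1 ?addr0 => [|beta nb].
  by rewrite ffunE eqxx scale1r actP // labof_rep.
by rewrite ffunE (negbTE nb) scale0r.
Qed.

Variables (a b : nat -> nat -> C) (lam : nat -> C).
Local Notation rho := (@rho R L n l a b lam).

Lemma rho_lin x c f g : rho x (c *: f + g) = c *: rho x f + rho x g.
Proof.
have ofb act h k : @ofbasis R n l act (c *: h + k) = c *: ofbasis act h + ofbasis act k.
  rewrite /ofbasis scaler_sumr -big_split; apply: eq_bigr => beta _.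
  by rewrite !ffunE scalerDl scalerA.
elim: x f g => //= [k|x IHx y IHy|x IHx y IHy] f g.
- by rewrite scalerDr !scalerA mulrC.
- by rewrite IHx IHy scalerDr addrACA.
- by rewrite IHy IHx.
Qed.

Lemma rho_scale x c f : rho x (c *: f) = c *: rho x f.
Proof. exact: (lin_scale (rho_lin x)). Qed.

Lemma rho_nest_sum x g (delta : nat -> nat -> nat -> nat -> int) X w m :
  rho x (nest_sum L bv g w delta X m)
  = \sum_(1 <= s < n.+1) \sum_(r : {ffun 'I_n -> 'I_n} | inR s r)
    ((\prod_(1 <= k < n.+1) g k (rv r k)) * (X s r * qint (w s (rv r s) m)))
      *: rho x (bv (m + \sum_(1 <= k < n.+1) delta k (rv r k))).
Proof.
(* The outer sum carries no coefficients; scaling by 1 gives it the form that [lin_sum] expects. *)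
under eq_bigr do rewrite -(lin_sum (rho_lin x)) -[rho x _]scale1r.
rewrite -(lin_sum (rho_lin x)); congr (rho x _).
by apply: eq_bigr => s _; rewrite scale1r.
Qed.

Lemma rho_E i m : rho (UE R i) (bv m) = @actE R L n l a b i m.
Proof.
apply: ofbasis_bv => m' mm'; apply: eq_bigr => j _; congr (_ * _ *: _).
  by apply: qint_cong; apply: congB; apply: labof_ent.
exact/bv_eq/labof_add.
Qed.

Lemma Mij_cong m m' i j : labof m' = labof m ->
  cong (Mij n (mplusb m' b) i j) (Mij n (mplusb m b) i j).
Proof.
move=> mm'; apply: congD; apply: cong_sum => k; apply: congB; exact: labof_ent.
Qed.

Lemma rho_F i m : rho (UF R i) (bv m) = @actF R L n l a b lam i m.
Proof.
apply: ofbasis_bv => m' mm'; apply: eq_bigr => j _; congr (_ * _ *: _).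
  by apply: qint_cong; apply: congB; [exact: Mij_cong | exact: cong_refl].
exact/bv_eq/labof_add.
Qed.

Lemma KLexp_cong m m' i : labof m' = labof m ->
  cong (KLexp n b lam i m') (KLexp n b lam i m).
Proof.
move=> mm'; apply: congD (cong_refl _); apply: congN; apply: cong_sum => k.
exact: labof_ent.
Qed.

Lemma rho_KL i m : rho (UKL R i) (bv m) = qpow (KLexp n b lam i m) *: bv m.
Proof.
apply: ofbasis_bv => m' mm'; congr (_ *: _); last exact: bv_eq.
exact/qpow_cong/KLexp_cong.
Qed.

Lemma rho_KLinv i m : rho (UKLinv R i) (bv m) = qpow (- KLexp n b lam i m) *: bv m.
Proof.
apply: ofbasis_bv => m' mm'; congr (_ *: _); last exact: bv_eq.
exact/qpow_cong/congN/KLexp_cong.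
Qed.

Lemma rho_qcomm x u v f :
  rho (qcomm x u v) f = rho u (rho v f) - x *: rho v (rho u f).
Proof. by rewrite /= scaleNr. Qed.

Lemma rho_nestDown g k f :
  rho (nestDown (qpow (-1)) g k.+1) f = nest L (fun k => rho (g k.+1)) k f.
Proof.
elim: k f => [//|k IHk] f.
by rewrite -[nestDown _ _ _]/(qcomm _ (g k.+2) (nestDown _ g k.+1)) rho_qcomm !IHk.
Qed.

Lemma rho_nestUp g k f :
  rho (nestUp n (qpow (-1)) g k) f = nest L (fun k => rho (g (n - k)%N)) k f.
Proof.
elim: k f => [|k IHk] f; first by rewrite /= subn0.
by rewrite -[nestUp _ _ _ _]/(qcomm _ (g (n - k.+1)%N) (nestUp n _ g k)) rho_qcomm !IHk.
Qed.

End Module.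

(** * Effect of the shifts on M, N and the Cartan exponent *)

Lemma sum_indicator (A : pzSemiRingType) (B : pred nat) (x y t0 : nat) :
  \sum_(x <= t < y) (B t && (t == t0))%:R = ((x <= t0 < y)%N && B t0)%:R :> A.
Proof.
elim: y => [|y IHy]; first by rewrite big_geq // andbF.
have [lexy|ltyx] := leqP x y; last by rewrite big_geq //; case: andP => //; lia.
rewrite big_nat_recr //= IHy; case: (eqVneq y t0) => [<-|ne].
  by rewrite andbT lexy ltnn ltnSn andbF /= add0r.
rewrite andbF addr0; congr (_%:R); congr (_ && _); lia.
Qed.

Lemma fun_sumE (I : Type) (s : seq I) (P : pred I) (F : I -> nat -> nat -> int) p q :
  (\sum_(i <- s | P i) F i) p q = \sum_(i <- s | P i) F i p q.
Proof. exact: (big_morph (fun f : nat -> nat -> int => f p q)). Qed.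

(** Only k = p+1 in the first sum and k = p in the second can contribute at (p, q). The entries +1
    thus lie on the diagonal q - p = n - i + 1, the entries -1 on q - p = n - i. *)
Lemma alphaijE n i j p q : (0 < j <= i)%N -> (i <= n)%N ->
  alphaij n i j p q = ((j <= p < i)%N && (q == (n - i + p).+1))%:R
                      - ((j <= p <= i)%N && (q == (n - i + p)%N))%:R.
Proof.
move=> hj hi; rewrite /alphaij /evec; congr (_ - _).
  under eq_big_nat => k hk.
    have -> : (p == k.-1) && (q == (n - i + k)%N) = (q == (n - i + k)%N) && (k == p.+1).
      by lia.
    over.
  by rewrite (sum_indicator _ (fun k => q == (n - i + k)%N)) addnS.
under eq_bigr => k _ do rewrite [p == k]eq_sym andbC.
by rewrite (sum_indicator _ (fun k => q == (n - i + k)%N)).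
Qed.

Section Shifts.
Variables (R : realType) (n : nat).
Local Notation C := (R[i]).
Variables (b : nat -> nat -> C).
Implicit Types (m d : nat -> nat -> int).

Local Notation e m := (ent n (mplusb m b)).

Lemma entE m p q : e m p q = (enti n m p q)%:~R + ent n b p q.
Proof. by rewrite /ent /enti /mplusb; case: ifP => // _; rewrite addr0. Qed.

Lemma ent_add m d p q : e (m + d) p q = e m p q + (enti n d p q)%:~R.
Proof.
rewrite !entE addrAC -intrD; congr (_%:~R + _).
by rewrite /enti; case: ifP => // _; rewrite addr0.
Qed.

Lemma ent_out (c : nat -> nat -> C) p q : (q < p)%N -> ent n c p q = 0.
Proof. by rewrite /ent /inrange => ltqp; case: ifP => //; lia. Qed.

Lemma enti_evec k j p q : inrange n k j ->
  enti n (evec k j) p q = ((p == k) && (q == j))%:R.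
Proof.
rewrite /enti /evec => kj; case: ifP => // pq.
by case: andP => // -[/eqP pk /eqP qj]; rewrite pk qj kj in pq.
Qed.

Lemma Mij_evec m i r k j : inrange n k j ->
  Mij n (mplusb (m + evec k j) b) i r = Mij n (mplusb m b) i r
   + (((i.-1 <= j < r)%N && (i == k))%:R - ((i.-1 <= j < r)%N && (i.-1 == k))%:R
      + (((i <= j < r.+1)%N && (i == k))%:R - ((i <= j < r.+1)%N && (i.+1 == k))%:R)).
Proof.
move=> kj; rewrite /Mij -!(sum_indicator _ (fun=> _ == k)) -!sumrB.
rewrite addrACA -!big_split /=; congr (_ + _); apply: eq_bigr => q _;
  rewrite !ent_add !enti_evec // !mulrz_nat; ring.
Qed.

(** Row k enters M_{k+1,j} only as -c_{k,q} with k <= q < j. *)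
Lemma Mij_next m k i j : (0 < k)%N -> inrange n k i -> inrange n k.+1 j ->
  Mij n (mplusb (m + evec k i) b) k.+1 j = Mij n (mplusb m b) k.+1 j - (i < j)%N%:R.
Proof.
rewrite {2}/inrange => k0 ki kj; rewrite Mij_evec //.
have -> : (k.+1 == k) = false by lia.
have -> : (k.+2 == k) = false by lia.
have -> : ((k.+1.-1 <= i < j)%N && (k.+1.-1 == k)) = (i < j)%N.
  by move: ki; rewrite /inrange; lia.
by rewrite !andbF subr0 addr0 sub0r.
Qed.

(** Row k+1 enters M_{k,i} only as -c_{k+1,q} with k <= q <= i. *)
Lemma Mij_prev m k i j : (0 < k)%N -> inrange n k i -> inrange n k.+1 j ->
  Mij n (mplusb (m + evec k.+1 j) b) k i = Mij n (mplusb m b) k i - (j <= i)%N%:R.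
Proof.
rewrite {1}/inrange => k0 ki kj; rewrite Mij_evec //.
have -> : (k == k.+1) = false by lia.
have -> : (k.-1 == k.+1) = false by lia.
have -> : ((k <= j < i.+1)%N && (k.+1 == k.+1)) = (j <= i)%N.
  by move: kj; rewrite /inrange; lia.
by rewrite !andbF subr0 sub0r add0r.
Qed.

Lemma Mij_far m k k' i j : (k.+1 < k')%N || (k'.+1 < k)%N -> inrange n k i ->
  Mij n (mplusb (m + evec k i) b) k' j = Mij n (mplusb m b) k' j.
Proof.
move=> kk' ki; rewrite Mij_evec //.
have -> : (k' == k) = false by lia.
have -> : (k'.-1 == k) = false by lia.
have -> : (k'.+1 == k) = false by lia.
by rewrite !andbF subr0 !addr0.
Qed.

Lemma enti_alphaij k r p q : (0 < r <= k)%N -> (k <= n)%N ->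
  enti n (alphaij n k r) p q = ((r <= p < k)%N && (q == (n - k + p).+1))%:R
                      - ((r <= p <= k)%N && (q == (n - k + p)%N))%:R.
Proof.
move=> hr hk; rewrite /enti alphaijE //; case: ifP => // pq.
have -> : (r <= p < k)%N && (q == (n - k + p).+1) = false.
  by move: pq; rewrite /inrange; lia.
by have -> : (r <= p <= k)%N && (q == (n - k + p)%N) = false
  by move: pq; rewrite /inrange; lia.
Qed.

(** N_{i,j} reads the diagonals n - i + 1 and n - i with signs + and -, while alpha_{k,r} has +1 on
    n - k + 1 and -1 on n - k. For i = k + 1 or i = k - 1 one diagonal is shared and any change is
    by -1; for more distant indices none is shared. *)
Lemma Nij_alphaij m i j k r : (0 < r <= k)%N -> (k <= n)%N ->
  Nij n (mplusb (m + alphaij n k r) b) i j = Nij n (mplusb m b) i j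
  + (((r <= j.-1 < k)%N && ((n - i + j)%N == (n - k + j.-1).+1))%:R
     - ((r <= j.-1 <= k)%N && ((n - i + j)%N == (n - k + j.-1)%N))%:R
     - ((r <= j < k)%N && ((n - i + j)%N == (n - k + j).+1))%:R
     + ((r <= j <= k)%N && ((n - i + j)%N == (n - k + j)%N))%:R).
Proof.
move=> hr hk; rewrite /Nij !ent_add !enti_alphaij // !intrB !mulrz_nat; ring.
Qed.

Lemma Nij_next m k i j : (0 < k < n)%N -> (0 < i <= k)%N -> (0 < j <= k.+1)%N ->
  Nij n (mplusb (m + alphaij n k i) b) k.+1 j = Nij n (mplusb m b) k.+1 j - (i < j)%N%:R.
Proof.
move=> hk hi hj; rewrite Nij_alphaij //; last by lia.
set B1 := (_ && _); set B2 := (_ && _); set B3 := (_ && _); set B4 := (_ && _).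
have -> : B1 = false by rewrite /B1; lia.
have -> : B2 = (i < j)%N by rewrite /B2; lia.
have -> : B3 = false by rewrite /B3; lia.
have -> : B4 = false by rewrite /B4; lia.
by rewrite subr0 addr0 sub0r.
Qed.

Lemma Nij_prev m k i j : (0 < k < n)%N -> (0 < i <= k)%N -> (0 < j <= k.+1)%N ->
  Nij n (mplusb (m + alphaij n k.+1 j) b) k i = Nij n (mplusb m b) k i - (j <= i)%N%:R.
Proof.
move=> hk hi hj; rewrite Nij_alphaij //; last by lia.
set B1 := (_ && _); set B2 := (_ && _); set B3 := (_ && _); set B4 := (_ && _).
have -> : B1 = false by rewrite /B1; lia.
have -> : B2 = false by rewrite /B2; lia.
have -> : B3 = (j <= i)%N by rewrite /B3; lia.
have -> : B4 = false by rewrite /B4; lia.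
by rewrite subr0 addr0 sub0r.
Qed.

Lemma Nij_far m k k' i j : (k.+1 < k')%N || (k'.+1 < k)%N -> (0 < i <= k)%N ->
  (0 < j <= k')%N -> (k <= n)%N -> (k' <= n)%N ->
  Nij n (mplusb (m + alphaij n k i) b) k' j = Nij n (mplusb m b) k' j.
Proof.
move=> kk' hi hj hk hk'; rewrite Nij_alphaij //.
set B1 := (_ && _); set B2 := (_ && _); set B3 := (_ && _); set B4 := (_ && _).
have -> : B1 = false by rewrite /B1; lia.
have -> : B2 = false by rewrite /B2; lia.
have -> : B3 = false by rewrite /B3; lia.
have -> : B4 = false by rewrite /B4; lia.
by rewrite !subr0 !addr0.
Qed.

(* [K_{Lambda_1} K_{Lambda_n}^-1] acts on v(m) through [- kap m]; [kap] is invariant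
   under the shifts by [eps_r] and [alpha_r]. *)
Definition kap m : C := \sum_(1 <= k < n.+1) e m 1 k - e m n n.
Definition kap0 d : int := \sum_(1 <= k < n.+1) enti n d 1 k - enti n d n n.

Lemma kap_add m d : kap (m + d) = kap m + (kap0 d)%:~R.
Proof.
rewrite /kap /kap0 intrB raddf_sum /= ent_add.
under eq_bigr do rewrite ent_add.
by rewrite big_split /=; ring.
Qed.

Lemma kap0_sum (I : Type) (s : seq I) (P : pred I) (F : I -> nat -> nat -> int) :
  kap0 (\sum_(i <- s | P i) F i) = \sum_(i <- s | P i) kap0 (F i).
Proof.
apply: (big_morph kap0) => [d d'|].
  have entiD p q : enti n (d + d') p q = enti n d p q + enti n d' p q.
    by rewrite /enti; case: ifP => // _; rewrite addr0.
  rewrite /kap0 entiD; under eq_bigr do rewrite entiD.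
  by rewrite big_split /=; ring.
have enti0 p q : enti n 0 p q = 0 by rewrite /enti; case: ifP.
by rewrite /kap0 enti0 big1.
Qed.

Lemma kap0_evec k j : inrange n k j -> kap0 (evec k j) = (k == 1%N)%:R - (j == n)%:R * (k == n)%:R.
Proof.
move=> kj; rewrite /kap0 enti_evec // ; under eq_bigr do rewrite enti_evec //.
rewrite (sum_indicator _ (fun=> 1%N == k)) [k == 1%N]eq_sym ![_ == n]eq_sym mulrC -natrM mulnb.
by have -> : (0 < j < n.+1)%N by move: kj; rewrite /inrange; lia.
Qed.

(** For k > 1 the contributions to row 1 cancel, which leaves alpha_{1,1}; the entry (n, n) is
    changed only when k = n. *)
Lemma kap0_alphaij k r : (0 < r <= k)%N -> (k <= n)%N ->
  kap0 (alphaij n k r) = (k == n)%:R - (r == 1%N)%:R * (k == 1%N)%:R.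
Proof.
move=> hr hk; rewrite /kap0 enti_alphaij //.
under eq_bigr do rewrite enti_alphaij //.
rewrite sumrB (sum_indicator _ (fun=> (r <= 1 < k)%N)) (sum_indicator _ (fun=> (r <= 1 <= k)%N)).
rewrite -natrM mulnb.
set B1 := (_ && _); set B2 := (_ && _); set B3 := (_ && _); set B4 := (_ && _); set B5 := (_ && _).
have -> : B3 = false by rewrite /B3; lia.
have -> : B4 = (k == n) by rewrite /B4; lia.
case: (ltngtP k 1%N) => hk1; first by lia.
  have -> : B1 = (r == 1%N) by rewrite /B1; lia.
  have -> : B2 = (r == 1%N) by rewrite /B2; lia.
  have -> : B5 = false by rewrite /B5; lia.
  by rewrite !subrr sub0r opprB.
have -> : B1 = false by rewrite /B1; lia.
have -> : B2 = B5 by rewrite /B2 /B5; lia.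
by rewrite !sub0r opprK addrC.
Qed.

End Shifts.

(** * Monomials in the parameters a *)

Section Monomials.
Variables (R : realType) (n : nat) (a : nat -> nat -> R[i]).
Hypothesis a_neq0 : forall i j, inrange n i j -> a i j != 0.

Lemma apow0 : apow n a 0 = 1.
Proof. by rewrite /apow big1 // => i _; rewrite big1. Qed.

Lemma apowD c d : apow n a (c + d) = apow n a c * apow n a d.
Proof.
rewrite /apow -big_split; apply: eq_big_nat => i hi.
rewrite -big_split; apply: eq_big_nat => j hj /=.
by rewrite [(c + d) i j]/(c i j + d i j) expfzDr // a_neq0 // /inrange; lia.
Qed.

Lemma apow_sum (I : Type) (s : seq I) (P : pred I) (F : I -> nat -> nat -> int) :
  apow n a (\sum_(i <- s | P i) F i) = \prod_(i <- s | P i) apow n a (F i).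
Proof. exact: (big_morph _ apowD apow0). Qed.

Lemma apow_evec k j : inrange n k j -> apow n a (evec k j) = ent n a k j.
Proof.
move=> kj; rewrite /ent kj /apow; move: kj; rewrite /inrange => kj.
rewrite (bigD1_seq k) ?iota_uniq ?mem_index_iota //=; last by lia.
rewrite (bigD1_seq j) ?iota_uniq ?mem_index_iota //=; last by lia.
rewrite [X in _ * X * _]big1 => [|q /negbTE qj]; last by rewrite /evec qj andbF.
rewrite [X in _ * X]big1 => [|p /negbTE pk]; last by rewrite big1 // => q _; rewrite /evec pk.
by rewrite /evec !eqxx !mulr1.
Qed.

End Monomials.

(** * Shape of the sequences in R^F and R^E *)

Section RootSequenceFacts.
Variables (n s : nat) (r : {ffun 'I_n -> 'I_n}).

Lemma rv_gt0 k : (0 < k <= n)%N -> (0 < rv r k)%N.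
Proof. by case: k => // k /= hk; rewrite /rv /= insubT. Qed.

Lemma rv_le k : (rv r k <= n)%N.
Proof. by rewrite /rv; case: k => // k /=; case: insubP. Qed.

Lemma inR_desc k : inR s r -> (0 < k < s)%N -> (s <= n)%N -> (rv r k.+1 <= rv r k)%N.
Proof.
move=> /forallP h hk hs; have ltk : (k.-1 < n)%N by lia.
have /andP[/implyP h1 _] := h (Ordinal ltk).
by move: h1; rewrite /= prednK; [apply; lia | lia].
Qed.

Lemma inR_asc k : inR s r -> (0 < k)%N -> (s <= k < n)%N -> (rv r k < rv r k.+1)%N.
Proof.
move=> /forallP h hk hs; have ltk : (k.-1 < n)%N by lia.
have /andP[_ /implyP h1] := h (Ordinal ltk).
by move: h1; rewrite /= prednK; [apply; lia | lia].
Qed.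

(** The list form matches [prod_ent], where this range condition decides which sequences keep their
    term. *)
Lemma inRF_all : inRF s r = inR s r && all (fun k => inrange n k (rv r k)) (index_iota 1 n.+1).
Proof.
rewrite /inRF; congr (_ && _); apply/forallP/allP => h k.
  rewrite mem_index_iota => hk; have ltk : (k.-1 < n)%N by lia.
  by move: (h (Ordinal ltk)); rewrite /= prednK /inrange; lia.
have := h k.+1; rewrite mem_index_iota /inrange => {}h.
by have := ltn_ord k; move: h; rewrite ?ltnS; move=> h hk; have := h hk; lia.
Qed.

Lemma inRE_all : inRE s r = inR s r && all (fun k => 0 < rv r k <= k)%N (index_iota 1 n.+1).
Proof.
rewrite /inRE; congr (_ && _); apply/forallP/allP => h k.
  rewrite mem_index_iota => hk; have ltk : (k.-1 < n)%N by lia.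
  by move: (h (Ordinal ltk)); rewrite /= prednK; lia.
have := h k.+1; rewrite mem_index_iota => {}h.
by have := ltn_ord k; move: h; rewrite ?ltnS; move=> h hk; have := h hk; lia.
Qed.

(** Downwards from n: r_n is squeezed between n and n, and then k <= r_k < r_{k+1} = k + 1. *)
Lemma inRF_diag k : inRF s r -> (0 < s)%N -> (s <= k <= n)%N -> rv r k = k.
Proof.
rewrite inRF_all => /andP[hr /allP hF] s0 hk.
have lek j : (0 < j <= n)%N -> (j <= rv r j)%N.
  by move=> hj; have := hF j; rewrite mem_index_iota /inrange; lia.
suff H d : (s <= n - d)%N -> (d < n)%N -> rv r (n - d) = (n - d)%N.
  by have <- : (n - (n - k) = k)%N; [lia | apply: H; lia].
elim: d => [|d IHd] hd hdn.
  by have := rv_le (n - 0); have := lek (n - 0)%N; lia.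
have E : ((n - d.+1).+1 = n - d)%N by lia.
have := @inR_asc (n - d.+1)%N hr; rewrite E IHd; try lia.
have := lek (n - d.+1)%N; lia.
Qed.

(** r_1 is squeezed between 1 and 1, and up to s the sequence descends weakly while staying
    positive. *)
Lemma inRE_one k : inRE s r -> (s <= n)%N -> (0 < k <= s)%N -> rv r k = 1%N.
Proof.
rewrite inRE_all => /andP[hr /allP hE] sn.
elim: k => // k IHk hk; have := rv_gt0 (k := k.+1).
case: k IHk hk => [|k] IHk hk.
  by have := hE 1%N; rewrite mem_index_iota; lia.
by have := inR_desc (k := k.+1) hr; rewrite IHk; lia.
Qed.

End RootSequenceFacts.

(** * The exponents C_E and D_F by telescoping *)

Section Exponents.
Variables (R : realType) (n s : nat) (r : {ffun 'I_n -> 'I_n}).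
Local Notation C := (R[i]).
Variables (c : nat -> nat -> C) (lam : nat -> C).
Local Notation e := (ent n c).
Let S i x := \sum_(0 <= p < x) e i p.

(** Entries left of the diagonal vanish, so the lower bound of a row sum can be moved to 0; M and
    C_E can then be compared through the prefix sums [S]. *)
Lemma sum_ent i x y : (x <= i)%N -> (x <= y)%N -> \sum_(x <= p < y) e i p = S i y.
Proof.
move=> xi xy; rewrite /S (big_cat_nat (leq0n x) xy) //=.
rewrite [X in _ = X + _]big_nat_cond [X in _ = X + _]big1 ?add0r // => p hp.
by rewrite ent_out //; lia.
Qed.

Lemma MijE i j : (0 < i)%N -> (i.-1 <= j)%N ->
  Mij n c i j = S i j - S i.-1 j + (S i j.+1 - S i.+1 j.+1).
Proof.
by move=> i0 ij; rewrite /Mij !sumrB !sum_ent //; lia.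
Qed.

Lemma S_diag i : S i i.+1 = e i i.
Proof.
rewrite /S big_nat_recr //= [X in X + _]big_nat_cond big1 ?add0r // => p hp.
by rewrite ent_out //; lia.
Qed.

Lemma S_low i : S i i = 0.
Proof.
rewrite /S big_nat_cond big1 // => p hp.
by rewrite ent_out //; lia.
Qed.

Lemma Mij_diag i : (0 < i)%N -> Mij n c i i = e i i - e i.-1 i.-1.
Proof.
case: i => // i _; rewrite MijE ?leq_pred //= !S_low !S_diag.
by rewrite sub0r subr0 addrC.
Qed.

Hypothesis hs : (0 < s <= n)%N.

(** For i > s the sequence is diagonal and M_{i,i} telescopes. For i < s both sides become prefix
    sums, which match after a shift of the index; the boundary terms are diagonal entries and the
    full row 1. *)
Lemma CE_eq : inRF s r -> CE c s r - lams n lam s =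
  \sum_(1 <= i < s) (Mij n c i (rv r i) - lam i)
  - \sum_(s.+1 <= i < n.+1) (Mij n c i (rv r i) - lam i)
  - (\sum_(1 <= k < n.+1) e 1 k - e n n).
Proof.
move=> hF; have := hF; rewrite inRF_all => /andP[hR /allP hall].
have lek j : (0 < j <= n)%N -> (j <= rv r j)%N.
  by move=> hj; have := hall j; rewrite mem_index_iota /inrange; lia.
have -> : \sum_(s.+1 <= i < n.+1) (Mij n c i (rv r i) - lam i)
    = e n n - e s s - \sum_(s.+1 <= i < n.+1) lam i.
  rewrite sumrB; congr (_ - _).
  rewrite (eq_big_nat _ _ (F2 := fun i => e i i - e i.-1 i.-1)); last first.
    by move=> i hi; rewrite (inRF_diag hF) ?Mij_diag //; lia.
  rewrite big_add1 /= (telescope_sumr (fun i => e i i)) //; lia.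
rewrite /lams sumrB.
have -> : \sum_(1 <= i < s) Mij n c i (rv r i) =
    \sum_(1 <= i < s) S i (rv r i) - \sum_(1 <= i < s) S i.-1 (rv r i)
    + (\sum_(1 <= i < s) S i (rv r i).+1 - \sum_(1 <= i < s) S i.+1 (rv r i).+1).
  rewrite -!sumrB -big_split; apply: eq_big_nat => i hi /=.
  by rewrite MijE //; have := lek i; lia.
rewrite sum_ent // -/(S 1 n.+1) /CE.
have rv0E k : (0 < k)%N -> rv0 r k = rv r k by case: k.
have subS k x y : (x <= y)%N -> \sum_(x <= p < y) e k p = S k y - S k x.
  by move=> xy; rewrite /S (big_cat_nat (leq0n x) xy) //= addrC addrK.
have -> : \sum_(1 <= k < s) \sum_(rv0 r k.+1 <= p < rv0 r k) e k p
    = \sum_(1 <= i < s) S i (rv r i) - \sum_(1 <= i < s) S i (rv r i.+1).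
  rewrite -sumrB; apply: eq_big_nat => i hi.
  have desc : (rv r i.+1 <= rv r i)%N by apply: inR_desc hR _ _; lia.
  by rewrite !rv0E ?subS //; lia.
(* The two sums differ by a telescoping one: r_s = s leaves the diagonal entry of row s-1, and row 0
   is zero. *)
have -> : \sum_(1 <= i < s) S i (rv r i.+1) = e s.-1 s.-1 + \sum_(1 <= i < s) S i.-1 (rv r i).
  apply/eqP; rewrite -subr_eq -sumrB; apply/eqP.
  rewrite (telescope_sumr (fun i => S i.-1 (rv r i))); last by lia.
  rewrite (inRF_diag hF); try lia.
  have -> : S 0 (rv r 1) = 0 by rewrite /S big1.
  by rewrite subr0 -S_diag prednK //; lia.
(* The convention r_0 = n turns the first upper bound into the full row 1; at the other end r_s = s
   gives a diagonal entry. *)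
have -> : \sum_(1 <= k < s.+1) \sum_((rv0 r k).+1 <= p < (rv0 r k.-1).+1) e k p
   = S 1 n.+1 + \sum_(1 <= i < s) S i.+1 (rv r i).+1
     - (\sum_(1 <= i < s) S i (rv r i).+1 + e s s).
  have hs1 : (1 <= s)%N by lia.
  have -> : e s s = S s (rv r s).+1 by rewrite (inRF_diag hF) ?S_diag //; lia.
  rewrite -(big_nat_recr _ _ (fun i => S i (rv r i).+1)) //=.
  rewrite [\sum_(1 <= i < s) S i.+1 _](eq_big_nat _ _
    (F2 := fun i => S i.+1 (rv0 r i).+1)); last first.
    by move=> i hi; rewrite rv0E //; lia.
  have -> : S 1 n.+1 = S 1 (rv0 r 0).+1 by [].
  rewrite -(big_ltn (F := fun i => S i.+1 (rv0 r i).+1)) //.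
  rewrite [\sum_(0 <= i < s) _](_ : _ = \sum_(1 <= i < s.+1) S i (rv0 r i.-1).+1);
    last by rewrite big_add1.
  rewrite -sumrB.
  apply: eq_big_nat => i hi; rewrite subS ?[rv0 r i]rv0E //; try lia.
  rewrite ltnS; case: i hi => // -[|i] hi /=; first exact: rv_le.
  by apply: inR_desc hR _ _; lia.
by ring.
Qed.

(** For i < s, r_i = 1 and N_{i,1} = -c_{1,n-i+1}: exactly the entries missing from the truncated
    row sum in D_F. *)
Lemma DF_eq : inRE s r -> DF c s r =
  \sum_(1 <= i < s) Nij n c i (rv r i) - \sum_(s.+1 <= i < n.+1) Nij n c i (rv r i)
  + (\sum_(1 <= k < n.+1) e 1 k - e n n).
Proof.
move=> hE; rewrite /DF -/(Nij n c _ _).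
have sn : (s <= n)%N by lia.
have -> : \sum_(1 <= i < s) Nij n c i (rv r i) = - \sum_((n - s).+2 <= k < n.+1) e 1 k.
  rewrite -sumrN big_nat_rev [in RHS](_ : (n - s).+2 = 1 + (n - s).+1)%N //.
  rewrite [RHS]big_addn.
  have -> : (n.+1 - (n - s).+1 = s)%N by lia.
  apply: eq_big_nat => i hi; rewrite (inRE_one hE) //; last by lia.
  rewrite /Nij /= {1}/ent /inrange sub0r; congr (- e _ _); lia.
rewrite (@big_cat_nat _ _ _ (n - s).+2 1 n.+1) //=; try lia.
rewrite /Nij; ring.
Qed.

End Exponents.

(** * Parity of the sign exponents *)

Section Signs.
Variables (A : pzRingType) (n s : nat).
Hypothesis hs : (0 < s <= n)%N.

Let eq_sign i j k : (i + k.*2 = j)%N -> (-1) ^+ i = (-1) ^+ j :> A.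
Proof. by move=> <-; rewrite -[RHS]signr_odd oddD odd_double addbF signr_odd. Qed.

Lemma sign_addn : (-1) ^+ (s + n) = (-1) ^+ (n - s) :> A.
Proof. by symmetry; apply: (eq_sign (k := s)); lia. Qed.

Lemma sign_succ_pred : (-1) ^+ (s + n) = (-1) ^+ n.+1 * (-1) ^+ s.-1 :> A.
Proof. by rewrite -exprD; congr (_ ^+ _); lia. Qed.

Lemma sign_pred : (-1) ^+ s.-1 = (-1) ^+ n.-1 * (-1) ^+ (n - s) :> A.
Proof. by rewrite -exprD; apply: (eq_sign (k := (n - s)%N)); lia. Qed.

Lemma sign_pred_succ : (-1) ^+ n.-1 * (-1) ^+ n.+1 = 1 :> A.
Proof. by rewrite -exprD -(expr0 (-1)); symmetry; apply: (eq_sign (k := n)); lia. Qed.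

End Signs.

(** * Evaluation: the action of E_0 and F_0 on basis vectors *)

Section Evaluation.
Variables (R : realType) (L : R[i]) (n l : nat).
Local Notation C := (R[i]).
Local Notation qpow := (qpow L).
Local Notation qint := (qint L).
Local Notation bv := (bv R n l).
Hypothesis n_gt0 : (0 < n)%N.
Hypothesis l_gt1 : (1 < l)%N.
Hypothesis ql : qpow 1 ^+ l = 1.
Hypothesis q_neq : qpow 1 - qpow (-1) != 0.
Variables (a b : nat -> nat -> C) (lam : nat -> C).
Hypothesis a_neq0 : forall i j, inrange n i j -> a i j != 0.
Local Notation rho := (@rho R L n l a b lam).
Local Notation lam1 := (lamL n lam 1).
Local Notation lamn := (lamL n lam n).

Definition nested (pm : bool) (U : nat -> uexp R) : uexp R :=
  if pm then nestDown (qpow (-1)) U n else nestUp n (qpow (-1)) U n.-1.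

Definition nested_coef (pm : bool) (w : nat -> nat -> (nat -> nat -> int) -> C) m s
    (r : {ffun 'I_n -> 'I_n}) : C :=
  if pm then (-1) ^+ (n - s) * qpow (wexp w r s m - s.-1%:R)
  else (-1) ^+ s.-1 * qpow (- wexp w r s m - (n - s)%N%:R).

(** The Cartan factor in the image of E_0; the one for F_0 is its inverse, [Kdiff (~~ pm)]. *)
Definition Kdiff (pm : bool) : uexp R :=
  if pm then UMul (UKL R 1) (UKLinv R n) else UMul (UKLinv R 1) (UKL R n).

Lemma rho_Kdiff pm m :
  rho (Kdiff pm) (bv m) = qpow (sgnC R pm * (lam1 - lamn - kap n b m)) *: bv m.
Proof.
have -> : lam1 - lamn - kap n b m = KLexp n b lam 1 m - KLexp n b lam n m.
  by rewrite /KLexp /kap big_nat1; ring.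
case: pm.
  change (rho (UKL R 1) (rho (UKLinv R n) (bv m)) = qpow (1 * (KLexp n b lam 1 m
    - KLexp n b lam n m)) *: bv m).
  by rewrite rho_KLinv // rho_scale rho_KL // scalerA -qpowD mul1r addrC.
change (rho (UKLinv R 1) (rho (UKL R n) (bv m)) = qpow (-1 * (KLexp n b lam 1 m
  - KLexp n b lam n m)) *: bv m).
by rewrite rho_KL // rho_scale rho_KLinv // scalerA -qpowD mulN1r opprB.
Qed.

Lemma signr_inv k : ((-1) ^+ k)^-1 = (-1) ^+ k :> C.
Proof. by rewrite -exprVn invrN invr1. Qed.

Lemma tev_E0 pm ab f : @tev R L n l a b lam pm ab (AE 0) f
  = (qpow (-1) * abold L n lam pm ab) *: rho (Kdiff pm) (rho (nested pm (UF R)) f).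
Proof. by case: pm. Qed.

Lemma tev_F0 pm ab f : @tev R L n l a b lam pm ab (AF 0) f
  = ((-1) ^+ n.-1 * qpow n%:R * (abold L n lam pm ab)^-1)
      *: rho (Kdiff (~~ pm)) (rho (nested pm (UE R)) f).
Proof. by case: pm. Qed.

Section Nested.
Variables (U : nat -> uexp R) (g : nat -> nat -> C).
Variables (w : nat -> nat -> (nat -> nat -> int) -> C).
Variables (delta : nat -> nat -> nat -> nat -> int).
Hypothesis U_v : forall k m, (0 < k <= n)%N ->
  rho (U k) (bv m) = \sum_(1 <= j < n.+1) (g k j * qint (w k j m)) *: bv (m + delta k j).
Hypothesis w_next : forall k i j m, (0 < k)%N -> (k < n)%N ->
  g k i != 0 -> g k.+1 j != 0 ->
  w k.+1 j (m + delta k i) = w k.+1 j m - (i < j)%N%:R.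
Hypothesis w_prev : forall k i j m, (0 < k)%N -> (k < n)%N ->
  g k i != 0 -> g k.+1 j != 0 ->
  w k i (m + delta k.+1 j) = w k i m - (j <= i)%N%:R.
Hypothesis w_far : forall k k' i j m, (0 < k)%N -> (k.+1 < k')%N -> (k' <= n)%N ->
  g k i != 0 -> g k' j != 0 ->
  w k' j (m + delta k i) = w k' j m /\ w k i (m + delta k' j) = w k i m.

Lemma rho_nested pm pm' m : rho (Kdiff pm') (rho (nested pm U) (bv m))
  = \sum_(1 <= s < n.+1) \sum_(r : {ffun 'I_n -> 'I_n} | inR s r)
    ((\prod_(1 <= k < n.+1) g k (rv r k))
       * (nested_coef pm w m s r * qint (w s (rv r s) m))
       * qpow (sgnC R pm'
           * (lam1 - lamn - kap n b (m + \sum_(1 <= k < n.+1) delta k (rv r k)))))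
    *: bv (m + \sum_(1 <= k < n.+1) delta k (rv r k)).
Proof.
have U_lin k c f h : rho (U k) (c *: f + h) = c *: rho (U k) f + rho (U k) h.
  exact: rho_lin.
have -> : rho (nested pm U) (bv m) = nest_sum L bv g w delta (nested_coef pm w m) m.
  case: pm; rewrite /nested.
    rewrite -[n in nestDown _ _ n]prednK // rho_nestDown.
    exact: (nest_down q_neq U_lin U_v).
  rewrite rho_nestUp; exact: (nest_up q_neq U_lin U_v).
rewrite rho_nest_sum; apply: eq_bigr => s _; apply: eq_bigr => r _.
by rewrite rho_Kdiff scalerA.
Qed.

End Nested.

Let wF k j m := Mij n (mplusb m b) k j - lam k.

Lemma rho_F_sum k m : (0 < k <= n)%N -> rho (UF R k) (bv m)
  = \sum_(1 <= j < n.+1) (ent n a k j * qint (wF k j m)) *: bv (m + evec k j).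
Proof.
move=> hk; rewrite rho_F // /actF (@big_cat_nat _ _ _ k 1 n.+1) /=; try lia.
rewrite [X in _ = X + _]big_nat_cond [X in _ = X + _]big1 ?add0r // => j hj.
by rewrite ent_out ?mul0r ?scale0r //; lia.
Qed.

Lemma ent_neq0 k j : ent n a k j != 0 -> inrange n k j.
Proof. by rewrite /ent; case: ifP => // _; rewrite eqxx. Qed.

Lemma prod_ent (r : {ffun 'I_n -> 'I_n}) :
  \prod_(1 <= k < n.+1) ent n a k (rv r k)
  = if all (fun k => inrange n k (rv r k)) (index_iota 1 n.+1) then apow n a (eps_r r) else 0.
Proof.
have -> : eps_r r = \sum_(1 <= k < n.+1) evec k (rv r k).
  by apply/funext => p; apply/funext => q; rewrite fun_sumE.
case: allP => [h|/allP/allPn[k hk nk]].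
  rewrite apow_sum // [LHS]big_seq [RHS]big_seq; apply: eq_bigr => k hk.
  by rewrite apow_evec // h.
by rewrite (bigD1_seq k) ?iota_uniq //= {1}/ent (negbTE nk) mul0r.
Qed.

Lemma eps_rE (r : {ffun 'I_n -> 'I_n}) :
  eps_r r = \sum_(1 <= k < n.+1) evec k (rv r k).
Proof. by apply/funext => p; apply/funext => q; rewrite fun_sumE. Qed.

(** The shift adds one unit to row 1 and, as r_n = n, one to the entry (n, n); the two cancel in
    [kap]. *)
Lemma kap_eps_r m s (r : {ffun 'I_n -> 'I_n}) : (0 < s <= n)%N -> inRF s r ->
  kap n b (m + eps_r r) = kap n b m.
Proof.
move=> hs hF; rewrite eps_rE kap_add kap0_sum.
rewrite (eq_big_nat _ _ (F2 := fun k => (k == 1%N)%:R - ((rv r k == n) && (k == n))%:R));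
    last first.
  move=> k hk; rewrite kap0_evec -?natrM ?mulnb //.
  move: hF; rewrite inRF_all => /andP[_ /allP]; apply.
  by rewrite mem_index_iota.
rewrite sumrB (sum_indicator _ (fun=> true)) (sum_indicator _ (fun k => rv r k == n)).
by rewrite (inRF_diag hF) ?eqxx ?andbT ?ltnS ?leqnn ?n_gt0 ?subrr ?addr0 //; lia.
Qed.

Lemma tev_E0_bv pm ab m : @tev R L n l a b lam pm ab (AE 0) (bv m)
  = E0rhs L n l a b lam pm ab m.
Proof.
rewrite tev_E0 (rho_nested (U := UF R) (g := ent n a) (w := wF) (delta := evec)); first last.
- move=> k k' i j m' hk hkk' hk' /ent_neq0 ki /ent_neq0 kj.
  by rewrite /wF !Mij_far // hkk' ?orbT.
- move=> k i j m' k0 _ /ent_neq0 ki /ent_neq0 kj.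
  by rewrite /wF Mij_prev // addrAC.
- move=> k i j m' k0 _ /ent_neq0 ki /ent_neq0 kj.
  by rewrite /wF Mij_next // addrAC.
- exact: rho_F_sum.
rewrite /E0rhs !scaler_sumr; apply: eq_big_nat => s hs.
rewrite !scaler_sumr [LHS]big_mkcond [RHS]big_mkcond; apply: eq_bigr => r _ /=.
rewrite prod_ent; have inF := inRF_all s r.
rewrite inF; case: (boolP (inR s r)) inF => //= hR; case: ifP => hF inF; last first.
  by rewrite !mul0r scale0r scaler0.
have hs' : (0 < s <= n)%N by lia.
rewrite -eps_rE !scalerA; congr (_ *: _); rewrite (kap_eps_r _ hs' inF).
(* At the turning point r_s = s, so M_{s,s} is a difference of diagonal entries. *)
have -> : wF s (rv r s) m = - (enti n m s.-1 s.-1)%:~R + (enti n m s s)%:~R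
             - ent n b s.-1 s.-1 + ent n b s s - lam s.
  rewrite /wF (inRF_diag inF); try lia.
  by rewrite Mij_diag ?entE; [ring | lia].
have CEq : CE (mplusb m b) s r - lams n lam s = wexp wF r s m - kap n b m.
  exact: CE_eq.
have sR : s%:R = s.-1%:R + 1 :> C by rewrite natr1 prednK //; lia.
have nR : (n - s)%:R = n%:R - s%:R :> C by rewrite natrB //; lia.
have nR2 : (2 * n)%N.+1%:R = 2 * n%:R + 1 :> C by rewrite -natr1 natrM.
(* The normalisation in [abold] cancels the lam1 - lamn of the Cartan factor and fixes the constant
   in the exponent. *)
case: pm; rewrite /nested_coef /abold /sgnC.
  have -> : qpow (1 * (CE (mplusb m b) s r - lams n lam s - s%:R) + n%:R)
     = qpow (-1) * qpow (- lam1 + lamn + n%:R) * qpow (wexp wF r s m - s.-1%:R)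
       * qpow (1 * (lam1 - lamn - kap n b m)).
    by rewrite -!qpowD CEq sR; congr Defs.qpow; ring.
  by rewrite (sign_addn _ hs'); ring.
have -> : qpow (-1 * (CE (mplusb m b) s r - lams n lam s - s%:R) + n%:R)
     = qpow (-1) * qpow (lam1 - lamn + (2 * n).+1%:R) * qpow (- wexp wF r s m - (n - s)%:R)
       * qpow (-1 * (lam1 - lamn - kap n b m)).
  by rewrite -!qpowD CEq nR nR2; congr Defs.qpow; ring.
by rewrite (sign_succ_pred _ hs'); ring.
Qed.

Let wE k j m := Nij n (mplusb m b) k j.
(** The cut-off at j <= k lets every operator sum over the same index range 1..n. *)
Let gE k j := if (0 < j <= k)%N then apow n a (alphaij n k j) else 0.

Lemma rho_E_sum k m : (0 < k <= n)%N -> rho (UE R k) (bv m)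
  = \sum_(1 <= j < n.+1) (gE k j * qint (wE k j m)) *: bv (m + alphaij n k j).
Proof.
move=> hk; rewrite rho_E // /actE (@big_cat_nat _ _ _ k.+1 1 n.+1) /=; try lia.
rewrite [X in _ = _ + X]big_nat_cond [X in _ = _ + X]big1 ?addr0 => [|j hj].
  by apply: eq_big_nat => j hj; rewrite /gE -ltnS hj.
by rewrite /gE; case: ifP; rewrite ?mul0r ?scale0r //; lia.
Qed.

Lemma gE_neq0 k j : gE k j != 0 -> (0 < j <= k)%N.
Proof. by rewrite /gE; case: ifP => // _; rewrite eqxx. Qed.

Lemma alpha_rE (r : {ffun 'I_n -> 'I_n}) :
  alpha_r r = \sum_(1 <= k < n.+1) alphaij n k (rv r k).
Proof. by apply/funext => p; apply/funext => q; rewrite fun_sumE. Qed.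

Lemma prod_gE (r : {ffun 'I_n -> 'I_n}) :
  \prod_(1 <= k < n.+1) gE k (rv r k)
  = if all (fun k => 0 < rv r k <= k)%N (index_iota 1 n.+1) then apow n a (alpha_r r) else 0.
Proof.
rewrite alpha_rE; case: allP => [h|/allP/allPn[k hk nk]].
  rewrite apow_sum // [LHS]big_seq [RHS]big_seq; apply: eq_bigr => k hk.
  by rewrite /gE h.
by rewrite (bigD1_seq k) ?iota_uniq //= {1}/gE (negbTE nk) mul0r.
Qed.

(** The sum of row 1 drops by one through alpha_{1,1}, and the entry (n, n) drops by one through the
    summand k = n. *)
Lemma kap_alpha_r m s (r : {ffun 'I_n -> 'I_n}) : (0 < s <= n)%N -> inRE s r ->
  kap n b (m + alpha_r r) = kap n b m.
Proof.
move=> hs hE; rewrite alpha_rE kap_add kap0_sum.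
rewrite (eq_big_nat _ _ (F2 := fun k => (k == n)%:R - ((rv r k == 1%N) && (k == 1%N))%:R));
    last first.
  move=> k hk; rewrite kap0_alphaij -?natrM ?mulnb //; last by lia.
  move: hE; rewrite inRE_all => /andP[_ /allP]; apply.
  by rewrite mem_index_iota.
rewrite sumrB (sum_indicator _ (fun=> true)) (sum_indicator _ (fun k => rv r k == 1%N)).
by rewrite (inRE_one hE) ?eqxx ?andbT ?ltnS ?leqnn ?n_gt0 ?subrr ?addr0 //; lia.
Qed.

Lemma tev_F0_bv pm ab m : @tev R L n l a b lam pm ab (AF 0) (bv m)
  = F0rhs L n l a b pm ab m.
Proof.
rewrite tev_F0 (rho_nested (U := UE R) (g := gE) (w := wE) (delta := alphaij n)); first last.
- move=> k k' i j m' hk hkk' hk' /gE_neq0 ki /gE_neq0 kj.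
  by rewrite /wE !Nij_far // ?hkk' ?orbT //; lia.
- move=> k i j m' k0 kn /gE_neq0 ki /gE_neq0 kj.
  by rewrite /wE Nij_prev // k0.
- move=> k i j m' k0 kn /gE_neq0 ki /gE_neq0 kj.
  by rewrite /wE Nij_next // k0.
- exact: rho_E_sum.
rewrite /F0rhs !scaler_sumr; apply: eq_big_nat => s hs.
rewrite !scaler_sumr [LHS]big_mkcond [RHS]big_mkcond; apply: eq_bigr => r _ /=.
rewrite prod_gE; have inE := inRE_all s r.
rewrite inE; case: (boolP (inR s r)) inE => //= hR; case: ifP => hE inE; last first.
  by rewrite !mul0r scale0r scaler0.
have hs' : (0 < s <= n)%N by lia.
rewrite -alpha_rE !scalerA; congr (_ *: _); rewrite (kap_alpha_r _ hs' inE).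
(* Here r_s = 1 and row 0 is zero, so N reduces to one entry of row 1. *)
have -> : wE s (rv r s) m = - (enti n m 1 (n - s).+1)%:~R - ent n b 1 (n - s).+1.
  rewrite /wE (inRE_one inE); try lia.
  by rewrite /Nij addn1 !entE /= {1}/enti {1}/ent /=; ring.
have DFq : DF (mplusb m b) s r = wexp wE r s m + kap n b m by exact: DF_eq.
have sR : s%:R = s.-1%:R + 1 :> C by rewrite natr1 prednK //; lia.
have nR : (n - s)%:R = n%:R - s%:R :> C by rewrite natrB //; lia.
have nR2 : (2 * n)%N.+1%:R = 2 * n%:R + 1 :> C by rewrite -natr1 natrM.
case: pm; rewrite /nested_coef /abold /sgnC !invfM -!qpowN ?signr_inv /=.
  have -> : qpow (1 * (DF (mplusb m b) s r - s%:R + n%:R + 1) - n%:R)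
     = qpow n%:R * qpow (- (- lam1 + lamn + n%:R)) * qpow (wexp wE r s m - s.-1%:R)
       * qpow (-1 * (lam1 - lamn - kap n b m)).
    by rewrite -!qpowD DFq sR; congr Defs.qpow; ring.
  by rewrite (sign_pred _ hs'); ring.
have -> : qpow (-1 * (DF (mplusb m b) s r - s%:R + n%:R + 1) - n%:R)
     = qpow n%:R * qpow (- (lam1 - lamn + (2 * n).+1%:R)) * qpow (- wexp wE r s m - (n - s)%:R)
       * qpow (1 * (lam1 - lamn - kap n b m)).
  by rewrite -!qpowD DFq nR nR2; congr Defs.qpow; ring.
(* The signs (-1)^(n-1) from [ev] and (-1)^(n+1) from [abold] cancel, which leaves (-1)^(s-1). *)
by rewrite -[RHS]mul1r -[X in _ = X * _](sign_pred_succ C hs'); ring.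
Qed.

End Evaluation.

Theorem theorem5p5 (R : realType) (n l : nat) (eps L : R[i])
  (a b : nat -> nat -> R[i]) (lam : nat -> R[i]) (ab : R[i]) :
  (0 < n)%N -> odd l -> (2 < l)%N -> coprime l n.+1 ->
  l.-primitive_root eps -> cexp L = eps ->
  (forall i j, inrange n i j -> a i j != 0) -> ab != 0 ->
  forall (pm : bool) (m : nat -> nat -> int),
  (forall i j, inrange n i j -> (0 <= m i j) && (m i j < l%:Z)) ->
  (forall i : nat, (1 <= i <= n)%N ->
     [/\ @tev R L n l a b lam pm ab (AE i) (bv R n l m)
           = @rho R L n l a b lam (UE R i) (bv R n l m),
         @tev R L n l a b lam pm ab (AF i) (bv R n l m)
           = @rho R L n l a b lam (UF R i) (bv R n l m) &
         @tev R L n l a b lam pm ab (AKa i) (bv R n l m)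
           = @rho R L n l a b lam (UKa R i) (bv R n l m)]) /\
  @tev R L n l a b lam pm ab (AE 0) (bv R n l m) = E0rhs L n l a b lam pm ab m /\
  @tev R L n l a b lam pm ab (AF 0) (bv R n l m) = F0rhs L n l a b pm ab m.
Proof.
move=> n0 _ l2 _ eps_prim epsL a0 _ pm m _.
have q1 : qpow L 1 = eps by rewrite /qpow mul1r.
have l1 : (1 < l)%N by lia.
have ql : qpow L 1 ^+ l = 1 by rewrite q1 (prim_expr_order eps_prim).
have q_neq : qpow L 1 - qpow L (-1) != 0.
  rewrite subr_eq0 qpowN; apply/eqP => qV.
  (* If eps equals its inverse, then eps^2 = 1 and the order l > 2 would divide 2. *)
  have : qpow L 1 ^+ 2 = 1 by rewrite expr2 {2}qV mulfV // qpow_neq0.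
  move/eqP; rewrite q1 -(prim_order_dvd eps_prim) => /dvdn_leq; lia.
(* The evaluation maps fix the generators with i >= 1, so these equations hold by computation. *)
split; first by case.
by split; [exact: tev_E0_bv | exact: tev_F0_bv].
Qed.
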